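(* Let $f,g:\Delta\to\mathbb{R}$ be monotonic with induced filtrations $(\Delta^t_f)_{t}$, $(\Delta^t_g)_{t}$. For every vertex $i\in[n]$, degree $q\ge0$, and multidegree $\alpha\in\mathbb{Z}^n$, $$d_b\big(\mathcal B^q_{i,\alpha}(f),\mathcal B^q_{i,\alpha}(g)\big)\le\|f-g\|_\infty,$$ and likewise $d_b\big(\mathcal B^q_{i,\operatorname{del},\sigma}(f),\mathcal B^q_{i,\operatorname{del},\sigma}(g)\big)\le\|f-g\|_\infty$ for every $\sigma\in\operatorname{del}_\Delta(i)$ and $d_b\big(\mathcal B^q_{i,\operatorname{lk},\sigma}(f),\mathcal B^q_{i,\operatorname{lk},\sigma}(g)\big)\le\|f-g\|_\infty$ for every $\sigma\in\operatorname{lk}_\Delta(i)$. Here $d_b$ is the bottleneck distance.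
   Context: $k$ is a field, $[n]=\{1,\dots,n\}$, $S=k[x_1,\dots,x_n]$ with the $\mathbb{Z}^n$-grading $\deg x_j=\mathbf e_j$. $\Delta$ is a simplicial complex on $[n]$ (a family of subsets closed under passing to subsets) of which every singleton is a face. For any complex $\Gamma$ on $[n]$, $I_\Gamma\subseteq S$ is generated by the monomials $\prod_{j\in\tau}x_j$, $\tau\subseteq[n]$, $\tau\notin\Gamma$, and $k[\Gamma]=S/I_\Gamma$ (zero for the void complex). $f:\Delta\to\mathbb{R}$ is monotonic if $f(\tau)\le f(\sigma)$ whenever $\tau\subseteq\sigma$; $\Delta^t_f=\{\sigma\in\Delta:f(\sigma)\le t\}$; $\|f-g\|_\infty=\sup_{\sigma\in\Delta}|f(\sigma)-g(\sigma)|$. For $s\le t$ the surjection $k[\Delta^t_f]\twoheadrightarrow k[\Delta^s_f]$ induces $\mathbb{Z}^n$-graded maps $\theta^{t\to s}_{i,q}:H^q_{\mathfrak p_i}(k[\Delta^t_f])\to H^q_{\mathfrak p_i}(k[\Delta^s_f])$ on local cohomology, $\mathfrak p_i=(x_j:j\ne i)\subseteq S$. $\mathbb V^q_{i,\alpha}(f)$ is the $\mathbb{R}^{\mathrm{op}}$-indexed persistence module (functor $\mathbb{R}^{\mathrm{op}}\to\mathrm{Vec}_k$) $t\mapsto H^q_{\mathfrak p_i}(k[\Delta^t_f])_\alpha$ with structure maps the restrictions of $\theta^{t\to s}_{i,q}$. It decomposes, uniquely up to permutation, as a finite direct sum of interval modules $k_{J}$ ($J\subseteq\mathbb{R}$ an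 interval; $k_J$ is $k$ on $J$, $0$ elsewhere, identity maps within $J$), and $\mathcal B^q_{i,\alpha}(f)$ is the multiset of these intervals. Multidegrees are written $\alpha=(c;b)$ with $c=\alpha_i$, $b=(\alpha_j)_{j\ne i}$; $\mathbf 1_\sigma=\sum_{j\in\sigma}\mathbf e_j$. With $\operatorname{del}_\Delta(i)=\{\tau\in\Delta:i\notin\tau\}$ and $\operatorname{lk}_\Delta(i)=\{\tau\subseteq[n]\setminus\{i\}:\tau\cup\{i\}\in\Delta\}$, set $\mathcal B^q_{i,\operatorname{del},\sigma}(f)=\mathcal B^q_{i,(0;-\mathbf 1_\sigma)}(f)$ for $\sigma\in\operatorname{del}_\Delta(i)$ and $\mathcal B^q_{i,\operatorname{lk},\sigma}(f)=\mathcal B^q_{i,(1;-\mathbf 1_\sigma)}(f)$ for $\sigma\in\operatorname{lk}_\Delta(i)$. The bottleneck distance between two barcodes is the usual one on the corresponding multisets of (birth, death) endpoints. *)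

(* Defs.v *)
From HB Require Import structures.
From mathcomp Require Import all_boot all_order all_algebra.
From mathcomp Require Import generic_quotient ring_quotient zify ring.
From mathcomp Require Import boolp classical_sets reals constructive_ereal.
From mathcomp Require Import -(notations) mpoly.

Set Implicit Arguments.
Unset Strict Implicit.
Unset Printing Implicit Defensive.

Import Order.TTheory GRing.Theory Num.Theory.
Local Open Scope ring_scope.
Local Open Scope quotient_scope.

Section Submodule.
Variables (A : nzRingType) (U : lmodType A) (W : submodClosed U).

Definition subm := {x : U | x \in W}.
HB.instance Definition _ := SubChoice.on subm.
HB.instance Definition _ := [SubChoice_isSubLmodule of subm by <:].
End Submodule.

Section SubmoduleMap.
Variables (A : nzRingType) (U V : lmodType A).
Variables (W : submodClosed U) (W' : submodClosed V) (phi : {linear U -> V}).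
Hypothesis phiW : forall x, x \in W -> phi x \in W'.

Definition subm_map (x : subm W) : subm W' := Sub (phi (val x)) (phiW (valP x)).

Lemma subm_map_linear : linear subm_map.
Proof. by move=> a x y; apply: val_inj; rewrite /= !linearP. Qed.
HB.instance Definition _ :=
  GRing.isLinear.Build A (subm W) (subm W') _ subm_map subm_map_linear.
End SubmoduleMap.

Section Quotient.
Variables (A : nzRingType) (U : lmodType A) (W : submodClosed U).

Definition submod_pred : {pred U} := fun x => x \in W.
HB.instance Definition _ :=
  GRing.isZmodClosed.Build U submod_pred (GRing.submod_closedB (submodClosedP W)).

Definition quotm := Quotient.quot submod_pred.
HB.instance Definition _ := GRing.Zmodule.on quotm.
HB.instance Definition _ := EqQuotient.on quotm.

Definition quotm_pi (x : U) : quotm := \pi_quotm x.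

Lemma quotm_eqP (x y : U) : reflect (quotm_pi x = quotm_pi y) (x - y \in W).
Proof.
by rewrite -[_ \in W]/(x - y \in submod_pred) Quotient.idealrBE; apply: eqP.
Qed.

Lemma quotm_reprK (x : U) : repr (quotm_pi x) - x \in W.
Proof. by apply/quotm_eqP; rewrite /quotm_pi reprK. Qed.

Lemma quotm_ind (P : quotm -> Prop) :
  (forall x, P (quotm_pi x)) -> forall u, P u.
Proof. by move=> P_pi u; rewrite -[u]reprK; apply: P_pi. Qed.

Definition quotm_scale (a : A) (u : quotm) : quotm := quotm_pi (a *: repr u).

Lemma quotm_piD (x y : U) : quotm_pi (x + y) = quotm_pi x + quotm_pi y.
Proof. exact: (@Quotient.pi_add _ submod_pred x y). Qed.

Lemma quotm_scaleE a x : quotm_scale a (quotm_pi x) = quotm_pi (a *: x).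
Proof. by apply/quotm_eqP; rewrite -scalerBr rpredZ ?quotm_reprK. Qed.

Fact quotm_scaleA a b u : quotm_scale a (quotm_scale b u) = quotm_scale (a * b) u.
Proof. by elim/quotm_ind: u => x; rewrite !quotm_scaleE scalerA. Qed.
Fact quotm_scale1 : left_id 1 quotm_scale.
Proof. by elim/quotm_ind=> x; rewrite quotm_scaleE scale1r. Qed.
Fact quotm_scaleDr : right_distributive quotm_scale +%R.
Proof.
move=> a; elim/quotm_ind=> x; elim/quotm_ind=> y.
by rewrite -quotm_piD !quotm_scaleE scalerDr quotm_piD.
Qed.
Fact quotm_scaleDl u : {morph quotm_scale^~ u : a b / a + b}.
Proof.
by elim/quotm_ind: u => x a b /=; rewrite !quotm_scaleE scalerDl quotm_piD.
Qed.
HB.instance Definition _ := GRing.Zmodule_isLmodule.Build A quotm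
  quotm_scaleA quotm_scale1 quotm_scaleDr quotm_scaleDl.

Fact quotm_pi_linear : linear quotm_pi.
Proof. by move=> a x y; rewrite quotm_piD -quotm_scaleE. Qed.
HB.instance Definition _ :=
  GRing.isLinear.Build A U quotm _ quotm_pi quotm_pi_linear.
End Quotient.
Arguments quotm_pi {A U} W x.

Section QuotientMap.
Variables (A : nzRingType) (U V : lmodType A).
Variables (W : submodClosed U) (W' : submodClosed V) (phi : {linear U -> V}).
Hypothesis phiW : forall x, x \in W -> phi x \in W'.

Definition quotm_map of (forall x, x \in W -> phi x \in W') :=
  fun u : quotm W => quotm_pi W' (phi (repr u)).

Lemma quotm_mapE x : quotm_map phiW (quotm_pi W x) = quotm_pi W' (phi x).
Proof. by apply/quotm_eqP; rewrite -linearB phiW ?quotm_reprK. Qed.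

Fact quotm_map_linear : linear (quotm_map phiW).
Proof.
move=> a; elim/quotm_ind=> x; elim/quotm_ind=> y.
by rewrite -quotm_pi_linear !quotm_mapE linearP quotm_pi_linear.
Qed.
HB.instance Definition _ := GRing.isLinear.Build A (quotm W) (quotm W') _
  (quotm_map phiW) quotm_map_linear.
End QuotientMap.

Section Product.
Variables (A : nzRingType) (I : Type) (U : I -> lmodType A).

Definition prodm := forall i, U i.
HB.instance Definition _ := gen_eqMixin prodm.
HB.instance Definition _ := gen_choiceMixin prodm.

Definition prodm0 : prodm := fun=> 0.
Definition prodmN (u : prodm) : prodm := fun i => - u i.
Definition prodmD (u v : prodm) : prodm := fun i => u i + v i.
Definition prodmZ a (u : prodm) : prodm := fun i => a *: u i.

Fact prodmA : associative prodmD.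
Proof. by move=> u v w; apply/functional_extensionality_dep=> i; apply: addrA. Qed.
Fact prodmC : commutative prodmD.
Proof. by move=> u v; apply/functional_extensionality_dep=> i; apply: addrC. Qed.
Fact prodm0D : left_id prodm0 prodmD.
Proof. by move=> u; apply/functional_extensionality_dep=> i; apply: add0r. Qed.
Fact prodmND : left_inverse prodm0 prodmN prodmD.
Proof. by move=> u; apply/functional_extensionality_dep=> i; apply: addNr. Qed.
HB.instance Definition _ :=
  GRing.isZmodule.Build prodm prodmA prodmC prodm0D prodmND.

Fact prodmZA a b u : prodmZ a (prodmZ b u) = prodmZ (a * b) u.
Proof. by apply/functional_extensionality_dep=> i; apply: scalerA. Qed.
Fact prodmZ1 : left_id 1 prodmZ.
Proof. by move=> u; apply/functional_extensionality_dep=> i; apply: scale1r. Qed.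
Fact prodmZDr : right_distributive prodmZ +%R.
Proof. by move=> a u v; apply/functional_extensionality_dep=> i; apply: scalerDr. Qed.
Fact prodmZDl u : {morph prodmZ^~ u : a b / a + b}.
Proof. by move=> a b; apply/functional_extensionality_dep=> i; apply: scalerDl. Qed.
HB.instance Definition _ := GRing.Zmodule_isLmodule.Build A prodm
  prodmZA prodmZ1 prodmZDr prodmZDl.

Lemma prodmP (u v : prodm) : (forall i, u i = v i) -> u = v.
Proof. exact: functional_extensionality_dep. Qed.
Lemma prodmPE a (u v : prodm) i : (a *: u + v) i = a *: u i + v i.
Proof. by []. Qed.
End Product.

Section ProductMap.
Variables (A : nzRingType) (I : Type) (U V : I -> lmodType A).
Variable phi : forall i, {linear U i -> V i}.

Definition prodm_map (u : prodm U) : prodm V := fun i => phi i (u i).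

Lemma prodm_map_linear : linear prodm_map.
Proof. by move=> a u v; apply: prodmP => i; rewrite /prodm_map prodmPE linearP. Qed.
HB.instance Definition _ :=
  GRing.isLinear.Build A (prodm U) (prodm V) _ prodm_map prodm_map_linear.
End ProductMap.

Section Restriction.
Variables (A B : nzRingType) (rho : {rmorphism A -> B}).

Definition resm of {rmorphism A -> B} := fun M : lmodType B => (M : Type).

Section Structure.
Variable M : lmodType B.
HB.instance Definition _ := GRing.Zmodule.on (resm rho M).
Definition resm_scale (a : A) (u : resm rho M) : resm rho M := rho a *: (u : M).

Fact resm_scaleA a b u : resm_scale a (resm_scale b u) = resm_scale (a * b) u.
Proof. by rewrite /resm_scale scalerA rmorphM. Qed.
Fact resm_scale1 : left_id 1 resm_scale.
Proof. by move=> u; rewrite /resm_scale rmorph1 scale1r. Qed.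
Fact resm_scaleDr : right_distributive resm_scale +%R.
Proof. by move=> a u v; apply: scalerDr. Qed.
Fact resm_scaleDl u : {morph resm_scale^~ u : a b / a + b}.
Proof. by move=> a b; rewrite /resm_scale rmorphD; apply: scalerDl. Qed.
HB.instance Definition _ := GRing.Zmodule_isLmodule.Build A (resm rho M)
  resm_scaleA resm_scale1 resm_scaleDr resm_scaleDl.
End Structure.

Variables (M N : lmodType B) (phi : {linear M -> N}).
Definition resm_map (u : resm rho M) : resm rho N := phi u.
Lemma resm_map_linear : linear resm_map.
Proof. by move=> a u v; rewrite /resm_map [LHS]linearP. Qed.
HB.instance Definition _ :=
  GRing.isLinear.Build A (resm rho M) (resm rho N) _ resm_map resm_map_linear.
End Restriction.
Arguments resm_map {A B} rho {M N} phi u.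

Section Localization.
Variables (A : comNzRingType) (M : lmodType A) (x : A).

Lemma scaler_swap (r s : A) (m : M) : r *: (s *: m) = s *: (r *: m).
Proof. by rewrite !scalerA mulrC. Qed.

(* The pair (m, a) stands for the fraction m / x ^+ a. *)
Definition loc_rel (u v : M * nat) : bool :=
  `[< exists c, x ^+ (c + v.2) *: u.1 = x ^+ (c + u.2) *: v.1 >].

Fact loc_rel_equiv : equiv_class_of loc_rel.
Proof.
split=> [u|u v|v u w].
- by apply/asboolP; exists 0%N.
- by apply: asbool_equiv_eq; split=> -[c e]; exists c.
- move=> /asboolP[c e1] /asboolP[c' e2]; apply/asboolP; exists (c + c' + v.2)%N.
  have -> : (c + c' + v.2 + w.2 = (c' + w.2) + (c + v.2))%N by lia.
  rewrite exprD -scalerA e1 scalerA mulrC -scalerA e2 scalerA -exprD.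
  by congr (x ^+ _ *: _); lia.
Qed.
Canonical loc_equiv := EquivRelPack loc_rel_equiv.
Canonical loc_encModRel := defaultEncModRel loc_rel.

Definition loc := {eq_quot loc_rel}.
HB.instance Definition _ := EqQuotient.on loc.
HB.instance Definition _ := Choice.on loc.

Definition frac (m : M) (a : nat) : loc := \pi_loc (m, a).

Lemma fracP m a m' b :
  frac m a = frac m' b <-> exists c, x ^+ (c + b) *: m = x ^+ (c + a) *: m'.
Proof.
split=> [/eqP|e]; last apply/eqP; first by rewrite piE => /asboolP.
by rewrite piE; apply/asboolP.
Qed.

Lemma loc_ind (P : loc -> Prop) : (forall m a, P (frac m a)) -> forall u, P u.
Proof. by move=> Pf u; rewrite -[u]reprK; case: (repr u). Qed.

Lemma frac_repr m a (u := repr (frac m a)) :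
  exists c, x ^+ (c + a) *: u.1 = x ^+ (c + u.2) *: m.
Proof. by apply/fracP; rewrite /frac -surjective_pairing reprK. Qed.

Lemma fracX c m a : frac (x ^+ c *: m) (c + a) = frac m a.
Proof. by apply/fracP; exists 0%N; rewrite scalerA -exprD; congr (x ^+ _ *: _); lia. Qed.

Definition loc_add (u v : loc) : loc :=
  let: (m, a) := repr u in let: (m', b) := repr v in
  frac (x ^+ b *: m + x ^+ a *: m') (a + b).
Definition loc_opp (u : loc) : loc := let: (m, a) := repr u in frac (- m) a.
Definition loc_scale (r : A) (u : loc) : loc :=
  let: (m, a) := repr u in frac (r *: m) a.

Lemma loc_addE m a m' b :
  loc_add (frac m a) (frac m' b) = frac (x ^+ b *: m + x ^+ a *: m') (a + b).
Proof.
rewrite /loc_add; have := frac_repr m a; have := frac_repr m' b.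
case: (repr (frac m a)) (repr (frac m' b)) => [p d] [p' d'] /= [c' e'] [c e].
apply/fracP; exists (c + c')%N; rewrite !scalerDr !scalerA -!exprD; congr +%R.
  have -> : (c + c' + (a + b) + d' = (c' + b + d') + (c + a))%N by lia.
  by rewrite exprD -scalerA e scalerA -exprD; congr (x ^+ _ *: _); lia.
have -> : (c + c' + (a + b) + d = (c + a + d) + (c' + b))%N by lia.
by rewrite exprD -scalerA e' scalerA -exprD; congr (x ^+ _ *: _); lia.
Qed.

Lemma loc_oppE m a : loc_opp (frac m a) = frac (- m) a.
Proof.
rewrite /loc_opp; have := frac_repr m a; case: (repr _) => [p d] /= [c e].
by apply/fracP; exists c; rewrite !scalerN e.
Qed.

Lemma loc_scaleE r m a : loc_scale r (frac m a) = frac (r *: m) a.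
Proof.
rewrite /loc_scale; have := frac_repr m a; case: (repr _) => [p d] /= [c e].
by apply/fracP; exists c; rewrite scaler_swap e scaler_swap.
Qed.

Fact loc_addA : associative loc_add.
Proof.
move=> u v w; elim/loc_ind: u => m a; elim/loc_ind: v => m' b.
elim/loc_ind: w => m'' c.
rewrite !loc_addE; apply/fracP; exists 0%N.
rewrite !scalerDr !scalerA -!exprD addrA.
by congr (x ^+ _ *: _ + x ^+ _ *: _ + x ^+ _ *: _); lia.
Qed.
Fact loc_addC : commutative loc_add.
Proof.
move=> u v; elim/loc_ind: u => m a; elim/loc_ind: v => m' b.
by rewrite !loc_addE addrC addnC.
Qed.
Fact loc_add0 : left_id (frac 0 0) loc_add.
Proof. by elim/loc_ind=> m a; rewrite loc_addE scaler0 add0r scale1r. Qed.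
Fact loc_addN : left_inverse (frac 0 0) loc_opp loc_add.
Proof.
elim/loc_ind=> m a; rewrite loc_oppE loc_addE scalerN addNr.
by apply/fracP; exists 0%N; rewrite !scaler0.
Qed.
HB.instance Definition _ :=
  GRing.isZmodule.Build loc loc_addA loc_addC loc_add0 loc_addN.

Fact loc_scaleA r s u : loc_scale r (loc_scale s u) = loc_scale (r * s) u.
Proof. by elim/loc_ind: u => m a; rewrite !loc_scaleE scalerA. Qed.
Fact loc_scale1 : left_id 1 loc_scale.
Proof. by elim/loc_ind=> m a; rewrite loc_scaleE scale1r. Qed.
Fact loc_scaleDr : right_distributive loc_scale +%R.
Proof.
move=> r; elim/loc_ind=> m a; elim/loc_ind=> m' b.
rewrite [_ + _]loc_addE !loc_scaleE [RHS]loc_addE.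
by rewrite scalerDr ![r *: (x ^+ _ *: _)]scaler_swap.
Qed.
Fact loc_scaleDl u : {morph loc_scale^~ u : r s / r + s}.
Proof.
elim/loc_ind: u => m a r s; rewrite !loc_scaleE [RHS]loc_addE.
by rewrite -scalerDr -scalerDl fracX.
Qed.
HB.instance Definition _ := GRing.Zmodule_isLmodule.Build A loc
  loc_scaleA loc_scale1 loc_scaleDr loc_scaleDl.

Lemma frac0 a : frac 0 a = 0.
Proof. by apply/fracP; exists 0%N; rewrite !scaler0. Qed.
Lemma fracD m a m' b :
  frac m a + frac m' b = frac (x ^+ b *: m + x ^+ a *: m') (a + b).
Proof. exact: loc_addE. Qed.
Lemma fracZ r m a : r *: frac m a = frac (r *: m) a.
Proof. exact: loc_scaleE. Qed.
End Localization.

Section LocalizationMap.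
Variables (A : comNzRingType) (M N : lmodType A) (x : A) (phi : {linear M -> N}).

Definition loc_map (u : loc M x) : loc N x :=
  let: (m, a) := repr u in frac x (phi m) a.

Lemma loc_mapE m a : loc_map (frac x m a) = frac x (phi m) a.
Proof.
rewrite /loc_map; have := frac_repr x m a; case: (repr _) => [p d] /= [c e].
by apply/fracP; exists c; have:= congr1 phi e; rewrite !linearZ.
Qed.

Lemma loc_map_linear : linear loc_map.
Proof.
move=> r; elim/loc_ind=> m a; elim/loc_ind=> m' b.
by rewrite fracZ fracD !loc_mapE fracZ fracD linearD !linearZ /= scaler_swap.
Qed.
HB.instance Definition _ :=
  GRing.isLinear.Build A (loc M x) (loc N x) _ loc_map loc_map_linear.
End LocalizationMap.

Section LocalizationChange.
Variables (A : comNzRingType) (M : lmodType A) (x y z : A).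

(* m / x ^+ a = (z ^+ a *: m) / y ^+ a when y = z * x. *)
Definition loc_change (u : loc M x) : loc M y :=
  let: (m, a) := repr u in frac y (z ^+ a *: m) a.

Hypothesis yE : y = z * x.

Lemma loc_changeE m a : loc_change (frac x m a) = frac y (z ^+ a *: m) a.
Proof.
rewrite /loc_change; have := frac_repr x m a; case: (repr _) => [p d] /= [c e].
apply/fracP; exists c; rewrite yE !exprMn !scalerA.
have -> : z ^+ (c + a) * x ^+ (c + a) * z ^+ d = z ^+ (c + a + d) * x ^+ (c + a).
  by rewrite [z ^+ (_ + d)]exprD; ring.
by rewrite -scalerA e scalerA; congr (_ *: _); rewrite !exprD; ring.
Qed.

Lemma loc_change_linear : linear loc_change.
Proof.
move=> r; elim/loc_ind=> m a; elim/loc_ind=> m' b.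
rewrite fracZ fracD !loc_changeE fracZ fracD.
apply/fracP; exists 0%N; rewrite yE !exprMn !scalerDr !scalerA.
by congr (_ *: _ + _ *: _); rewrite !exprD; ring.
Qed.
End LocalizationChange.
Section Graded.
Variables (k : fieldType) (n : nat).
Local Notation S := (mpoly n k).

Definition multideg := {ffun 'I_n -> int}.
HB.instance Definition _ := GRing.Zmodule.on multideg.

Definition mnm_multideg (m : multinom n) : multideg := [ffun j => (m j)%:Z].

Definition indic (F : {set 'I_n}) : multideg := [ffun j => (j \in F)%:Z].

Definition homog (alpha : multideg) : {pred S} :=
  fun p => all (fun m => mnm_multideg m == alpha) (msupp p).

Definition varprod (F : {set 'I_n}) : S := \prod_(j in F) mpolyX k (mnm1 j).

Lemma homog0 alpha : 0 \in homog alpha.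
Proof. by rewrite unfold_in msupp0. Qed.

Lemma homogD alpha p p' :
  p \in homog alpha -> p' \in homog alpha -> p + p' \in homog alpha.
Proof.
move=> /allP hp /allP hp'; apply/allP => m /msuppD_le.
by rewrite mem_cat => /orP[/hp|/hp'].
Qed.

Lemma homogM alpha beta p p' :
  p \in homog alpha -> p' \in homog beta -> p * p' \in homog (alpha + beta).
Proof.
move=> /allP hp /allP hp'; apply/allP => m /msuppM_le /allpairsP[[m1 m2] /= []].
move=> /hp /eqP<- /hp' /eqP<- ->; apply/eqP/ffunP => j.
by rewrite !ffunE mnmDE PoszD.
Qed.

Lemma homogC c : mpolyC n c \in homog 0.
Proof.
apply/allP => m; rewrite msuppC; case: eqP => //= _; rewrite inE => /eqP ->.
by apply/eqP/ffunP => j; rewrite !ffunE mnm0E.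
Qed.

Lemma homogX p alpha a : p \in homog alpha -> p ^+ a \in homog (alpha *+ a).
Proof.
move=> hp; elim: a => [|a IH]; first by rewrite expr0 mulr0n -[1]/(mpolyC n 1) homogC.
by rewrite exprS mulrS homogM.
Qed.

Lemma homog_varprod F : varprod F \in homog (indic F).
Proof.
have -> : indic F = \sum_(j in F) mnm_multideg (mnm1 j).
  apply/ffunP => l; rewrite sum_ffunE ffunE (eq_bigr (fun j => (l == j)%:Z)).
    have [lF|lF] := boolP (l \in F).
      rewrite (bigD1 l) //= eqxx big1 ?addr0 // => j /andP[_ /negPf].
      by rewrite eq_sym => ->.
    by rewrite big1 // => j jF; case: eqP lF => // ->; rewrite jF.
  by move=> j _; rewrite ffunE mnm1E eq_sym.
rewrite /varprod; elim/big_ind2: _ => [|p a p' b hp hp'|j _]; first exact: homogC 1.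
  exact: homogM.
by apply/allP => m; rewrite msuppX inE => /eqP ->.
Qed.

Lemma varprodD (F G : {set 'I_n}) :
  F \subset G -> varprod G = varprod (G :\: F) * varprod F.
Proof.
move=> FG; rewrite mulrC /varprod (big_setID F) /=.
by rewrite (finset.setIidPr FG).
Qed.

(* Only the axioms of a Z^n-graded module that are needed to form the homogeneous
   components of local cohomology are recorded: that the module is the direct sum
   of its components is not used. *)
Record gmodule := GModule {
  gcar :> lmodType S;
  gcomp : multideg -> {pred gcar};
  gcomp0 : forall alpha, 0 \in gcomp alpha;
  gcompD : forall alpha u v,
    u \in gcomp alpha -> v \in gcomp alpha -> u + v \in gcomp alpha;
  gcompZ : forall alpha beta p u,
    p \in homog beta -> u \in gcomp alpha -> p *: u \in gcomp (alpha + beta)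
}.

Arguments gcomp : clear implicits.

Record ghom (M N : gmodule) := GHom {
  gfun :> {linear M -> N};
  gfunP : forall alpha u, u \in gcomp M alpha -> gfun u \in gcomp N alpha
}.

Section Cech.
Variables (P : {set 'I_n}) (M : gmodule).

(* All the localizations are gathered in one product; the q-th term of the Cech
   complex is the submodule of the families supported on the subsets of P of
   cardinal q. *)
Definition cech := prodm (fun F : {set 'I_n} => loc M (varprod F)).
HB.instance Definition _ := GRing.Lmodule.on cech.

Definition cech_res (F G : {set 'I_n}) :
    loc M (varprod F) -> loc M (varprod G) :=
  @loc_change _ M (varprod F) (varprod G) (varprod (G :\: F)).

Fact cech_res_linear (F G : {set 'I_n}) : F \subset G -> linear (@cech_res F G).
Proof. by move=> FG; apply: loc_change_linear; apply: varprodD. Qed.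

Definition cech_d (c : cech) : cech := fun G =>
  \sum_(j in G :&: P)
    (-1) ^+ #|[set l in G | (l < j)%N]| *: cech_res G (c (G :\ j)).

Fact cech_d_linear : linear cech_d.
Proof.
move=> r c c'; apply: prodmP => G; rewrite [RHS]prodmPE /cech_d.
rewrite scaler_sumr -big_split; apply: eq_bigr => j _.
have -> := cech_res_linear (finset.subsetDl G [set j]) r (c (G :\ j)) (c' (G :\ j)).
by rewrite scalerDr scaler_swap.
Qed.
HB.instance Definition _ := GRing.isLinear.Build S cech cech _ cech_d cech_d_linear.

Definition is_cochain (q : nat) (c : cech) :=
  forall F : {set 'I_n}, ~~ ((F \subset P) && (#|F| == q)) -> c F = 0.

Definition cocycle q : {pred cech} :=
  fun c => `[< is_cochain q c /\ cech_d c = 0 >].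

Fact cocycle_closed q : GRing.submod_closed (cocycle q).
Proof.
split=> [|r c c' /asboolP[sc dc] /asboolP[sc' dc']]; apply/asboolP.
  by split=> //; rewrite linear0.
split=> [F hF|]; last by rewrite cech_d_linear dc dc' scaler0 addr0.
by rewrite [LHS]prodmPE sc // sc' // scaler0 addr0.
Qed.
HB.instance Definition _ q := GRing.isSubmodClosed.Build S cech (cocycle q)
  (GRing.submod_closed_semi (cocycle_closed q)).

(* When q = 0 the condition on c forces c = 0. *)
Definition coboundary q : {pred subm (cocycle q)} :=
  fun b => `[< exists c : cech,
    (forall F : {set 'I_n}, ~~ ((F \subset P) && (#|F|.+1 == q)) -> c F = 0)
    /\ val b = cech_d c >].

Fact coboundary_closed q : GRing.submod_closed (@coboundary q).
Proof.
split=> [|r b b' /asboolP[c [sc bc]] /asboolP[c' [sc' bc']]]; apply/asboolP.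
  by exists 0; split=> //; rewrite [RHS](linear0 cech_d).
exists (r *: c + c'); split=> [F hF|]; last by rewrite cech_d_linear -bc -bc'.
by rewrite [LHS]prodmPE sc // sc' // scaler0 addr0.
Qed.
HB.instance Definition _ q :=
  GRing.isSubmodClosed.Build S (subm (cocycle q)) (@coboundary q)
    (GRing.submod_closed_semi (coboundary_closed q)).

(* Local cohomology at the ideal (x_j : j in P), as Cech cohomology on its
   generators: the grading and the functoriality are those of the complex. *)
Definition lcoh q := quotm (@coboundary q).
HB.instance Definition _ q := GRing.Lmodule.on (lcoh q).

Definition loc_comp F (alpha : multideg) : {pred loc M (varprod F)} :=
  fun u => `[< exists m a,
    m \in gcomp M (alpha + indic F *+ a) /\ u = frac (varprod F) m a >].

Definition lcoh_comp q (alpha : multideg) :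
    {pred resm (@mpolyC n k) (lcoh q)} :=
  fun h => `[< exists z : subm (cocycle q),
    (forall F, val z F \in loc_comp alpha) /\ h = quotm_pi (@coboundary q) z >].

Lemma loc_comp0 F alpha : 0 \in @loc_comp F alpha.
Proof. by apply/asboolP; exists 0, 0%N; rewrite gcomp0 frac0. Qed.

Lemma loc_compP F alpha c u v : u \in @loc_comp F alpha ->
  v \in @loc_comp F alpha -> mpolyC n c *: u + v \in @loc_comp F alpha.
Proof.
move=> /asboolP[m [a [hm ->]]] /asboolP[m' [b [hm' ->]]]; apply/asboolP.
rewrite fracZ fracD; eexists _, _; split; last reflexivity.
have hX d := homogX d (homog_varprod F).
apply: gcompD.
  rewrite mulrnDr addrA; apply: gcompZ => //.
  by rewrite -[_ + _ *+ _]addr0; apply: gcompZ => //; apply: homogC.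
by rewrite addnC mulrnDr addrA; apply: gcompZ.
Qed.

Fact lcoh_comp_closed q alpha : GRing.submod_closed (@lcoh_comp q alpha).
Proof.
split=> [|c h h' /asboolP[z [hz ->]] /asboolP[z' [hz' ->]]]; apply/asboolP.
  exists 0; split=> [F|]; first exact: loc_comp0.
  by rewrite linear0.
exists (mpolyC n c *: z + z'); split=> [F|].
  exact: (loc_compP c (hz F) (hz' F)).
by rewrite linearP.
Qed.
HB.instance Definition _ q alpha :=
  GRing.isSubmodClosed.Build k (resm (@mpolyC n k) (lcoh q))
    (@lcoh_comp q alpha) (GRing.submod_closed_semi (lcoh_comp_closed q alpha)).

Definition lcoh_deg q alpha : lmodType k := subm (@lcoh_comp q alpha).
End Cech.

Section CechMap.
Variables (P : {set 'I_n}) (M N : gmodule) (phi : ghom M N).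

Definition cech_map : {linear cech M -> cech N} :=
  prodm_map (fun F => @loc_map _ M N (varprod F) phi : {linear _ -> _}).

Lemma cech_mapE (c : cech M) F : cech_map c F = loc_map phi (c F).
Proof. by []. Qed.

Lemma cech_res_map (F G : {set 'I_n}) (u : loc M (varprod F)) : F \subset G ->
  cech_res G (loc_map phi u) = loc_map phi (cech_res G u).
Proof.
move=> FG; elim/loc_ind: u => m a; rewrite loc_mapE /cech_res.
by rewrite !(loc_changeE (varprodD FG)) loc_mapE linearZ.
Qed.

Lemma cech_d_map c : cech_d P (cech_map c) = cech_map (cech_d P c).
Proof.
apply: prodmP => G; rewrite cech_mapE /cech_d linear_sum; apply: eq_bigr => j _.
rewrite linearZ /= cech_res_map //; exact: finset.subsetDl.
Qed.

Fact cech_map_cocycle q c : c \in cocycle P q -> cech_map c \in cocycle P q.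
Proof.
move=> /asboolP[sc dc]; apply/asboolP; split; last by rewrite cech_d_map dc linear0.
by move=> F hF; rewrite cech_mapE sc // linear0.
Qed.

Definition cocycle_map q : {linear subm (cocycle P q) -> subm (cocycle P q)} :=
  subm_map (@cech_map_cocycle q).

Fact cocycle_map_coboundary q b :
  b \in coboundary (q := q) -> cocycle_map q b \in coboundary (q := q).
Proof.
move=> /asboolP[c [sc bc]]; apply/asboolP; exists (cech_map c); split.
  by move=> F hF; rewrite cech_mapE sc // linear0.
by rewrite cech_d_map -bc.
Qed.

Definition lcoh_map q : {linear lcoh P M q -> lcoh P N q} :=
  quotm_map (@cocycle_map_coboundary q).

Fact lcoh_map_comp q alpha h :
  h \in lcoh_comp alpha -> resm_map (@mpolyC n k) (lcoh_map q) h \in lcoh_comp alpha.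
Proof.
move=> /asboolP[z [hz ->]]; apply/asboolP; exists (cocycle_map q z); split.
  move=> F; have /asboolP[m [a [hm zF]]] := hz F; apply/asboolP.
  exists (phi m), a; split; first exact: gfunP.
  by rewrite -loc_mapE -zF.
by rewrite /resm_map /lcoh_map /= quotm_mapE.
Qed.

Definition lcoh_deg_map q alpha :
    {linear lcoh_deg P M q alpha -> lcoh_deg P N q alpha} :=
  subm_map (@lcoh_map_comp q alpha).

Lemma lcoh_deg_mapE q alpha (x : lcoh_deg P M q alpha)
    (y : lcoh_deg P N q alpha) (z : subm (cocycle P q)) :
  val x = quotm_pi (@coboundary P M q) z ->
  (val y = quotm_pi (@coboundary P N q) (cocycle_map q z)) ->
  lcoh_deg_map q alpha x = y.
Proof.
by move=> hx hy; apply: val_inj; rewrite hy /= hx /resm_map /lcoh_map /= quotm_mapE.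
Qed.
End CechMap.
End Graded.
Arguments gcomp {k n} g alpha.

Section CechFunctor.
Variables (k : fieldType) (n : nat) (P : {set 'I_n}).

Lemma lcoh_deg_map_id (M : gmodule k n) (phi : ghom M M) q alpha
    (x : lcoh_deg P M q alpha) :
  (forall u, phi u = u) -> lcoh_deg_map P phi q alpha x = x.
Proof.
move=> phi1; case: x => h hh; elim/quotm_ind: h hh => z hh.
apply: (@lcoh_deg_mapE _ _ _ _ _ _ _ _ _ _ z) => //=.
congr (quotm_pi _ _); apply: val_inj; apply: prodmP => F.
rewrite /= cech_mapE; elim/loc_ind: (val z F) => m a.
by rewrite loc_mapE phi1.
Qed.

Lemma lcoh_deg_map_comp (M N L : gmodule k n) (phi : ghom M N) (psi : ghom N L)
    (chi : ghom M L) q alpha (x : lcoh_deg P M q alpha) :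
  (forall u, chi u = psi (phi u)) ->
  lcoh_deg_map P chi q alpha x =
  lcoh_deg_map P psi q alpha (lcoh_deg_map P phi q alpha x).
Proof.
move=> chiE; case: x => h hh; elim/quotm_ind: h hh => z hh.
apply: (@lcoh_deg_mapE _ _ _ _ _ _ _ _ _ _ z) => //=.
rewrite /resm_map /lcoh_map /= !quotm_mapE.
congr (quotm_pi _ _); apply: val_inj; apply: prodmP => F.
rewrite /= !cech_mapE; elim/loc_ind: (val z F) => m a.
by rewrite !loc_mapE chiE.
Qed.
End CechFunctor.

Section StanleyReisner.
Variables (k : fieldType) (n : nat).
Local Notation S := (mpoly n k).

Definition sr_ideal (Gamma : {set {set 'I_n}}) : {pred S^o} :=
  fun p => `[< exists c : {set 'I_n} -> S,
    p = \sum_(tau | tau \notin Gamma) c tau * varprod k tau >].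

Fact sr_ideal_closed Gamma : GRing.submod_closed (sr_ideal Gamma).
Proof.
split=> [|r p p' /asboolP[c ->] /asboolP[c' ->]]; apply/asboolP.
  by exists (fun=> 0); rewrite big1 // => tau _; rewrite mul0r.
exists (fun tau => r * c tau + c' tau).
rewrite scaler_sumr -big_split; apply: eq_bigr => tau _ /=.
by rewrite mulrDl -mulrA.
Qed.
HB.instance Definition _ Gamma := GRing.isSubmodClosed.Build S S^o (sr_ideal Gamma)
  (GRing.submod_closed_semi (sr_ideal_closed Gamma)).

Definition sr_quot Gamma := quotm (sr_ideal Gamma).
HB.instance Definition _ Gamma := GRing.Lmodule.on (sr_quot Gamma).

Definition sr_comp Gamma (alpha : multideg n) : {pred sr_quot Gamma} :=
  fun u => `[< exists2 p : S, p \in homog alpha & u = quotm_pi (sr_ideal Gamma) p >].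

Fact sr_comp0 Gamma alpha : 0 \in @sr_comp Gamma alpha.
Proof. by apply/asboolP; exists 0; rewrite ?homog0 // linear0. Qed.

Fact sr_compD Gamma alpha u v : u \in @sr_comp Gamma alpha ->
  v \in sr_comp alpha -> u + v \in sr_comp alpha.
Proof.
move=> /asboolP[p hp ->] /asboolP[p' hp' ->]; apply/asboolP.
by exists (p + p'); rewrite ?homogD // linearD.
Qed.

Fact sr_compZ Gamma alpha beta p u : p \in homog beta ->
  u \in @sr_comp Gamma alpha -> p *: u \in sr_comp (alpha + beta).
Proof.
move=> hp /asboolP[p' hp' ->]; apply/asboolP.
by exists (p * p'); rewrite 1?addrC ?homogM // -linearZ.
Qed.

(* For the void complex the empty monomial 1 is among the generators of the ideal,
   and the module is zero. *)
Definition sr_module Gamma : gmodule k n :=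
  GModule (@sr_comp0 Gamma) (@sr_compD Gamma) (@sr_compZ Gamma).

Section Surjection.
Variables (Gamma Gamma' : {set {set 'I_n}}) (sub : Gamma' \subset Gamma).

Fact sr_ideal_sub p : p \in sr_ideal Gamma -> (idfun : {linear S^o -> S^o}) p \in sr_ideal Gamma'.
Proof.
move=> /asboolP[c ->]; apply/asboolP.
exists (fun tau => if tau \in Gamma then 0 else c tau).
rewrite [RHS](bigID (mem Gamma)) /= [X in _ = X + _]big1 ?add0r; last first.
  by move=> tau /andP[_ ->]; rewrite mul0r.
apply: eq_big => [tau|tau /negPf -> //].
by have [/(fintype.subsetP sub) ->|] := boolP (tau \in Gamma').
Qed.

Definition sr_linear : {linear sr_module Gamma -> sr_module Gamma'} :=
  quotm_map sr_ideal_sub.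

Lemma sr_linearE (p : S) :
  sr_linear (quotm_pi (sr_ideal Gamma) p) = quotm_pi (sr_ideal Gamma') p.
Proof. exact: quotm_mapE. Qed.

Fact sr_linear_comp alpha u :
  u \in gcomp (sr_module Gamma) alpha -> sr_linear u \in gcomp (sr_module Gamma') alpha.
Proof.
by move=> /asboolP[p hp ->]; apply/asboolP; exists p; rewrite // sr_linearE.
Qed.

Definition sr_map : ghom (sr_module Gamma) (sr_module Gamma') := GHom sr_linear_comp.
End Surjection.

Lemma sr_map_id (Gamma : {set {set 'I_n}}) (sub : Gamma \subset Gamma) u : sr_map sub u = u.
Proof. by elim/quotm_ind: u => p; apply: sr_linearE. Qed.

Lemma sr_map_comp (Gamma Gamma' Gamma'' : {set {set 'I_n}}) (sub : Gamma' \subset Gamma)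
    (sub' : Gamma'' \subset Gamma') (sub'' : Gamma'' \subset Gamma) u :
  sr_map sub'' u = sr_map sub' (sr_map sub u).
Proof.
elim/quotm_ind: u => p; rewrite [LHS]sr_linearE.
by rewrite [in RHS](sr_linearE sub p : sr_map sub _ = _) [RHS]sr_linearE.
Qed.
End StanleyReisner.

Section Persistence.
Variables (R : realType) (k : fieldType).

Record pmodule := PModule {
  pobj :> R -> lmodType k;
  pmap : forall t s : R, s <= t -> {linear pobj t -> pobj s};
  pmap_id : forall t (le_tt : t <= t) x, pmap le_tt x = x;
  pmap_comp : forall t s r (le_st : s <= t) (le_rs : r <= s) (le_rt : r <= t) x,
    pmap le_rt x = pmap le_rs (pmap le_st x)
}.

Definition pmodule_iso (V W : pmodule) :=
  exists phi : forall t, {linear V t -> W t},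
    (forall t, bijective (phi t)) /\
    (forall t s (le_st : s <= t) x, phi s (pmap V le_st x) = pmap W le_st (phi t x)).

Section DirectSum.
Variables (I : finType) (V : I -> pmodule).

Definition psum_map t s (le_st : s <= t) :
    {linear prodm (fun i => V i t) -> prodm (fun i => V i s)} :=
  prodm_map (fun i => pmap (V i) le_st).

Fact psum_map_id t (le_tt : t <= t) x : psum_map le_tt x = x.
Proof. by apply: prodmP => i; apply: pmap_id. Qed.

Fact psum_map_comp t s r (le_st : s <= t) (le_rs : r <= s) (le_rt : r <= t) x :
  psum_map le_rt x = psum_map le_rs (psum_map le_st x).
Proof. by apply: prodmP => i; apply: pmap_comp. Qed.

(* The index type is finite, so that direct sums are products. *)
Definition psum : pmodule :=
  @PModule (fun t => prodm (fun i => V i t)) psum_map psum_map_id psum_map_comp.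
End DirectSum.

Section Interval.
Variable J : interval R.

(* k on J and 0 elsewhere: the space of row vectors of length 1 or 0. A structure
   map multiplies by the matrix of ones, which is 1 x 1 inside J and otherwise
   has no row or no column. *)
Definition kint (t : R) : lmodType k := 'rV[k]_(t \in J).

Definition kint_map t s of s <= t : {linear kint t -> kint s} :=
  mulmxr (const_mx 1 : 'M[k]_(t \in J, s \in J)).

Fact ones_id (a : bool) : const_mx 1 = 1%:M :> 'M[k]_a.
Proof.
by case: a; apply/matrixP => i j; rewrite !mxE ?(ord1 i) ?(ord1 j) //; case: i.
Qed.

Fact ones_mul (a b c : bool) : (a && c ==> b) ->
  (const_mx 1 : 'M[k]_(a, b)) *m (const_mx 1 : 'M_(b, c)) = const_mx 1.
Proof.
case: a b c => [] [] [] //= _; apply/matrixP => i j; rewrite !mxE.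
all: by [rewrite big_ord1 !mxE mulr1 | case: i | case: j].
Qed.

Fact kint_map_id t (le_tt : t <= t) x : kint_map le_tt x = x.
Proof. by rewrite /kint_map /= ones_id mulmx1. Qed.

Fact kint_map_comp t s r (le_st : s <= t) (le_rs : r <= s) (le_rt : r <= t) x :
  kint_map le_rt x = kint_map le_rs (kint_map le_st x).
Proof.
rewrite /kint_map /= -mulmxA ones_mul //; apply/implyP => /andP[].
case: J => l u; rewrite !itv_boundlr => /andP[_ tu] /andP[lr _].
by rewrite (le_trans lr) ?(le_trans _ tu) ?bnd_simp.
Qed.

Definition interval_module : pmodule :=
  @PModule kint kint_map kint_map_id kint_map_comp.
End Interval.

(* A barcode, i.e. a multiset of intervals, is represented by a sequence. *)
Definition is_barcode (V : pmodule) (B : seq (interval R)) : Prop :=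
  (forall J, J \in B -> exists t, t \in J) /\
  pmodule_iso V (psum (fun m : 'I_(size B) => interval_module (tnth (in_tuple B) m))).

(* The intervals of a decomposition are unique up to permutation, on which the
   bottleneck distance does not depend, so that any choice will do. *)
Definition barcode (V : pmodule) : seq (interval R) := xget [::] (is_barcode V).
End Persistence.

Section Bottleneck.
Variable R : realType.
Local Open Scope ereal_scope.

Definition bound_ereal (b : itv_bound R) : \bar R :=
  match b with
  | BSide _ x => x%:E
  | BInfty true => -oo
  | BInfty false => +oo
  end.

Definition lower_end (J : interval R) : \bar R := let: Interval l _ := J in bound_ereal l.
Definition upper_end (J : interval R) : \bar R := let: Interval _ u := J in bound_ereal u.

(* Two equal infinite endpoints are at distance 0. *)
Definition endpoint_dist (x y : \bar R) : \bar R := if x == y then 0 else `|x - y|.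

Definition bar_dist (J J' : interval R) : \bar R :=
  maxe (endpoint_dist (lower_end J) (lower_end J'))
       (endpoint_dist (upper_end J) (upper_end J')).

Definition diag_dist (J : interval R) : \bar R :=
  (upper_end J - lower_end J) * (2^-1)%:E.

Section Matching.
Variables B C : seq (interval R).

Definition partial_matching (m : {ffun 'I_(size B) -> option 'I_(size C)}) : bool :=
  [forall i, forall j, (m i == m j) && (m i != None) ==> (i == j)].

Definition matching_cost (m : {ffun 'I_(size B) -> option 'I_(size C)}) : \bar R :=
  maxe (\big[maxe/0]_i
          (if m i is Some j then bar_dist (tnth (in_tuple B) i) (tnth (in_tuple C) j)
           else diag_dist (tnth (in_tuple B) i)))
       (\big[maxe/0]_(j | [forall i, m i != Some j]) diag_dist (tnth (in_tuple C) j)).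

Definition bottleneck : \bar R := \big[mine/+oo]_(m | partial_matching m) matching_cost m.
End Matching.
End Bottleneck.

Section Filtration.
Variables (R : realType) (k : fieldType) (n : nat).

Definition simplicial_complex (Delta : {set {set 'I_n}}) : Prop :=
  forall sigma tau : {set 'I_n}, sigma \in Delta -> tau \subset sigma -> tau \in Delta.

(* A function on Delta is represented by a function on all sets of vertices, of
   which only the values on Delta matter. *)
Definition monotonic (Delta : {set {set 'I_n}}) (f : {set 'I_n} -> R) : Prop :=
  forall tau sigma : {set 'I_n}, tau \in Delta -> sigma \in Delta ->
    tau \subset sigma -> f tau <= f sigma.

Definition sublevel (Delta : {set {set 'I_n}}) (f : {set 'I_n} -> R) (t : R) :
  {set {set 'I_n}} := [set sigma in Delta | f sigma <= t].

Definition sup_dist (Delta : {set {set 'I_n}}) (f g : {set 'I_n} -> R) : R :=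
  sup [set `|f sigma - g sigma| | sigma in [set sigma | sigma \in Delta]]%classic.

Lemma sublevel_sub Delta f s t : s <= t -> sublevel Delta f s \subset sublevel Delta f t.
Proof.
move=> st; apply/fintype.subsetP => sigma; rewrite !inE => /andP[-> /=].
by move/le_trans; apply.
Qed.

Section LocalCohomology.
Variables (Delta : {set {set 'I_n}}) (f : {set 'I_n} -> R).
Variables (i : 'I_n) (q : nat) (alpha : multideg n).

Definition lc_obj (t : R) : lmodType k :=
  lcoh_deg [set~ i] (sr_module k (sublevel Delta f t)) q alpha.

Definition lc_map t s (le_st : s <= t) : {linear lc_obj t -> lc_obj s} :=
  lcoh_deg_map [set~ i] (sr_map k (sublevel_sub Delta f le_st)) q alpha.

Fact lc_map_id t (le_tt : t <= t) x : lc_map le_tt x = x.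
Proof. by apply: lcoh_deg_map_id => u; apply: sr_map_id. Qed.

Fact lc_map_comp t s r (le_st : s <= t) (le_rs : r <= s) (le_rt : r <= t) x :
  lc_map le_rt x = lc_map le_rs (lc_map le_st x).
Proof. by apply: lcoh_deg_map_comp => u; apply: sr_map_comp. Qed.

Definition lc_pmodule : pmodule R k :=
  @PModule R k lc_obj lc_map lc_map_id lc_map_comp.

Definition lc_barcode : seq (interval R) := barcode lc_pmodule.
End LocalCohomology.

(* The multidegree (c; - 1_sigma). *)
Definition neg_multideg (i : 'I_n) (c : int) (sigma : {set 'I_n}) : multideg n :=
  [ffun j => if j == i then c else - (j \in sigma)%:Z].

Definition del (Delta : {set {set 'I_n}}) (i : 'I_n) : {set {set 'I_n}} :=
  [set tau in Delta | i \notin tau].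

Definition lk (Delta : {set {set 'I_n}}) (i : 'I_n) : {set {set 'I_n}} :=
  [set tau : {set 'I_n} | (i \notin tau) && ((i |: tau)%SET \in Delta)].

Definition del_barcode Delta f i q sigma :=
  lc_barcode Delta f i q (neg_multideg i 0 sigma).

Definition lk_barcode Delta f i q sigma :=
  lc_barcode Delta f i q (neg_multideg i 1 sigma).
End Filtration.

(* Main.v *)
Require Import Defs.
From HB Require Import structures.
From mathcomp Require Import all_boot all_order all_algebra.
From mathcomp Require Import lra.
From mathcomp Require Import boolp classical_sets reals constructive_ereal.
From mathcomp Require Import -(notations) mpoly.

(* If f and g order the faces compatibly, both filtrations run through the same chain of
   initial segments of one list of faces. The local cohomology of this chain is
   finite-dimensional (each localization of k[Gamma] has dimension at most 1 in each
   degree), so it splits into intervals [p, r] of positions in the list; replacing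
   positions by the values of f, resp. g, gives the two barcodes, with a matching whose
   cost is at most |f - g|. In general one moves from f to g along f + u (g - f): the
   compatibility is lost only at finitely many parameters u, and the costs of the steps
   add up to |f - g|, because a barcode is unique up to permutation. *)

Set Implicit Arguments.
Unset Strict Implicit.
Unset Printing Implicit Defensive.

Import Order.TTheory GRing.Theory Num.Theory.
Local Open Scope ring_scope.

(** * Decomposition of finite chains of vector spaces *)

(** Both barcodes come from one decomposition of the chain, so bars are matched by their common
    index; a bar goes to the diagonal when a tie makes its real interval empty for just one of the
    two functions. A segment that cuts a tie need not be a complex, but k[Gamma] is formed for any
    family of sets. Since [barcode] is an arbitrary choice, every comparison, also at the
    intermediate functions, passes through uniqueness. Decompositions are handled as families of
    sections because the summands [kint] are rows whose length depends on t. *)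

Section LinearAlgebra.
Variable k : fieldType.

Lemma sum_option (V : nmodType) (I : finType) (F : option I -> V) :
  \sum_o F o = F None + \sum_i F (Some i).
Proof.
rewrite (bigD1 None) //=; congr +%R.
rewrite (reindex_omap Some id) //=; last by case.
by apply: eq_bigl => i; rewrite eqxx.
Qed.

(** Stated for scalars alone: it serves for vectors of one space and for Cech cocycles, whose
    coordinates live in different localizations. *)
Lemma underdetermined (I J : finType) (A : {set I}) (B : {set J}) (g : I -> J -> k) :
  (#|B| < #|A|)%N -> exists c : I -> k,
    (exists2 i, i \in A & c i != 0) /\ forall j, j \in B -> \sum_(i in A) c i * g i j = 0.
Proof.
move=> BA; pose G : 'M[k]_(#|A|, #|B|) := \matrix_(a, b) g (enum_val a) (enum_val b).
have /rowV0Pn[u /sub_kermxP uG u0] : kermx G != 0.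
  by rewrite -mxrank_eq0 mxrank_ker subn_eq0 -ltnNge (leq_ltn_trans (rank_leq_col G)).
have /set0Pn[i0 Ai0] : A != finset.set0 by rewrite -card_gt0 (leq_ltn_trans _ BA).
exists (fun i => u 0 (enum_rank_in Ai0 i)); split.
  have /rV0Pn[a ua] := u0; exists (enum_val a); first exact: enum_valP.
  by rewrite enum_valK_in.
move=> j Bj; rewrite big_enum_val /=.
have := congr1 (fun M : 'rV_#|B| => M 0 (enum_rank_in Bj j)) uG; rewrite !mxE; apply: etrans.
by apply: eq_bigr => a _; rewrite !mxE enum_valK_in enum_rankK_in.
Qed.

Lemma free_card_le (V : lmodType k) (I J : finType) (A : {set I}) (B : {set J})
    (v : I -> V) (w : J -> V) (g : I -> J -> k) :
  (forall c, \sum_(i in A) c i *: v i = 0 -> forall i, i \in A -> c i = 0) ->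
  (forall i, i \in A -> v i = \sum_(j in B) g i j *: w j) -> (#|A| <= #|B|)%N.
Proof.
move=> free_v vE; rewrite leqNgt; apply/negP => /(@underdetermined _ _ _ _ g).
move=> [c [[a Aa /eqP ca] cg]]; apply: ca; apply: free_v Aa.
under eq_bigr => i Ai do rewrite vE // scaler_sumr.
rewrite exchange_big big1 //= => j Bj.
under eq_bigr do rewrite scalerA.
by rewrite -scaler_suml cg // scale0r.
Qed.

Definition indep (V : lmodType k) (I : finType) (v : I -> V) :=
  forall c : I -> k, \sum_i c i *: v i = 0 -> forall i, c i = 0.

(** Local cohomology arrives as a bare [lmodType]; bounding independent families makes sense before
    any basis is known. *)
Definition dim_le (V : lmodType k) (N : nat) :=
  forall (I : finType) (v : I -> V), indep v -> (#|I| <= N)%N.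

(** An independent family of maximal size spans, since a vector outside its span would extend it. *)
Lemma dim_le_basis (V : lmodType k) N : dim_le V N ->
  exists (I : finType) (b : I -> V),
    indep b /\ forall y, exists c : I -> k, y = \sum_i c i *: b i.
Proof.
move=> leN.
pose P m := `[< exists (I : finType) (b : I -> V), #|I| = m /\ indep b >].
have P0 : exists m, P m.
  exists 0%N; apply/asboolP; exists 'I_0, (fun=> 0); split; first exact: card_ord.
  by move=> c _ [].
have Ple m : P m -> (m <= N)%N by move=> /asboolP[I [b [<- /leN]]].
have [m /asboolP[I [b [Im bP]]] mmax] := ex_maxnP P0 Ple.
exists I, b; split=> // y; apply: contrapT => ybig.
suff /mmax : P m.+1 by rewrite ltnn.
apply/asboolP; exists (option I), (fun o => if o is Some i then b i else y).
split; first by rewrite card_option Im.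
move=> c; rewrite sum_option => c0.
have cN : c None = 0.
  apply/eqP; apply: contrapT => /negP cN; apply: ybig.
  exists (fun i => - (c None)^-1 * c (Some i)).
  under eq_bigr do rewrite -scalerA.
  rewrite -scaler_sumr scaleNr -scalerN.
  move/eqP: c0; rewrite addr_eq0 => /eqP <-.
  by rewrite scalerA mulVf ?scale1r.
move: c0; rewrite cN scale0r add0r => /bP cS [i|//]; exact: cS.
Qed.

(** An equality, and not only an isomorphism, lets a whole chain be replaced by [vectType]s with its
    maps untouched. *)
Lemma dim_le_vectType (V : lmodType k) N : dim_le V N ->
  exists W : vectType k, V = W.
Proof.
move=> /dim_le_basis[I [b [bP bS]]].
pose C y := projT1 (cid (bS y)).
have CE y : y = \sum_i C y i *: b i by rewrite /C; case: (cid _).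
have Cu y c : y = \sum_i c i *: b i -> forall i, C y i = c i.
  move=> yc i; apply/eqP; rewrite -subr_eq0; apply/eqP.
  apply: (bP (fun i => C y i - c i)).
  under eq_bigr do rewrite scalerBl.
  by rewrite sumrB -CE -yc subrr.
pose f y : 'rV[k]_#|I| := \row_a C y (enum_val a).
have lin_f : linear f.
  move=> a y z; apply/rowP => j; rewrite !mxE.
  apply: (Cu _ (fun i => a * C y i + C z i)).
  under eq_bigr do rewrite scalerDl -scalerA.
  by rewrite big_split -scaler_sumr -!CE.
have bij_f : bijective f.
  exists (fun u : 'rV[k]_#|I| => \sum_i u 0 (enum_rank i) *: b i) => [y|u].
    rewrite {2}[y]CE; apply: eq_bigr => i _; by rewrite mxE enum_rankK.
  by apply/rowP => a; rewrite mxE (Cu _ _ erefl) enum_valK.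
have ax : vector_axiom_def #|I| V by exists f.
pose W : vectType k := HB.pack V (Lmodule_hasFinDim.Build k V ax).
(* Once V is destructured, it is convertible to the module underlying W. *)
by exists W; move: @W; clear -ax; case: V ax.
Qed.
End LinearAlgebra.

Section ChainDecomposition.
Variables (k : fieldType) (N : nat) (D : 'I_N -> vectType k).
Variable A : forall j i, 'Hom(D j, D i).
Hypothesis A_id : forall j x, A j j x = x.
Hypothesis A_comp : forall (l j i : 'I_N) x, (i <= j)%N -> (j <= l)%N ->
  A j i (A l j x) = A l i x.

(* The longest interval [p, q] on which some element of U q survives down to p splits
   off: a linear form detecting the survivor at p cuts out a complement. *)
Lemma chain_decomposition (U : forall j, {vspace D j}) :
  (forall (j i : 'I_N) x, (i <= j)%N -> x \in U j -> A j i x \in U i) ->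
  exists (I : finType) (p q : I -> 'I_N) (x : forall a j, D j),
  [/\ forall (a : I) j, x a j \in U j,
      forall a (j : 'I_N), ~~ (p a <= j <= q a)%N -> x a j = 0,
      forall a (j i : 'I_N), (i <= j)%N -> (p a <= j <= q a)%N -> A j i (x a j) = x a i,
      forall j y, y \in U j -> exists c : I -> k, y = \sum_a c a *: x a j
    & forall (j : 'I_N) (c : I -> k), \sum_a c a *: x a j = 0 ->
        forall a, (p a <= j <= q a)%N -> c a = 0].
Proof.
(* The ambient spaces stay fixed and only the subchain shrinks, so the complement is again an
   instance. *)
have [m] := ubnP (\sum_j \dim (U j))%N; elim: m U => // m IH U; rewrite ltnS => dimU AU.
pose P (b : 'I_N * 'I_N) :=
  (b.1 <= b.2)%N && `[< exists2 v, v \in U b.2 & A b.2 b.1 v != 0 >].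
have [[b0 Pb0]|Pn] := pselect (exists b, P b); last first.
  have U0 j y : y \in U j -> y = 0.
    move=> Uy; apply: contrapT => /eqP y0; apply: Pn; exists (j, j); rewrite /P leqnn /=.
    by apply/asboolP; exists y; rewrite ?A_id.
  exists void, (of_void _), (of_void _), (fun _ _ => 0).
  split=> // j y /U0 ->.
  by exists (fun=> 0); rewrite big1 // => -[].
case: (arg_maxnP (fun b : 'I_N * 'I_N => b.2 - b.1)%N Pb0) => -[p q] /andP[/= pq /asboolP[/= v Uv Av0]] max_pq.
pose w := A q p v.
pose lam : {linear D p -> k^o} := coord [tuple w] ord0.
have lamw : lam w = 1.
  have fw : free [tuple w] by rewrite /free span_seq1 dim_vline Av0.
  by have := coord_free ord0 ord0 fw; rewrite eqxx.
pose U' j : {vspace D j} :=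
  if (p <= j <= q)%N then (U j :&: lker (linfun lam \o A j p))%VS else U j.
have U'P j y : reflect (y \in U j /\ ((p <= j <= q)%N -> lam (A j p y) = 0)) (y \in U' j).
  rewrite /U'; case: ifP => [_|]; last by move=> _; apply: (iffP idP) => [|[]].
  rewrite memv_cap memv_ker comp_lfunE lfunE /=.
  apply: (iffP andP) => [[-> /eqP]|[-> ->]] //=; by split.
have U'U j : (U' j <= U j)%VS by apply/subvP => y /U'P[].
have U'v : v \notin U' q.
  apply/negP => /U'P[_]; rewrite pq leqnn => /(_ isT); rewrite -/w lamw => /eqP.
  by rewrite oner_eq0.
have dimU' : (\sum_j \dim (U' j) < m)%N.
  apply: leq_trans dimU; rewrite (bigD1 q) //= [X in (_ < X)%N](bigD1 q) //= -addSn.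
  apply: leq_add; last by apply: leq_sum => j _; apply: dimvS.
  rewrite ltn_neqAle dimvS // andbT; apply/negP => /eqP edim.
  by case/negP: U'v; have /eqP -> : U' q == U q by rewrite eqEdim U'U edim leqnn.
have max_len (j i : 'I_N) y : (i <= j)%N -> (q - p < j - i)%N -> y \in U j -> A j i y = 0.
  move=> ij big Uy; apply: contrapT => /eqP Ay.
  have /max_pq /= : P (i, j) by rewrite /P ij; apply/asboolP; exists y.
  by rewrite leqNgt big.
(* An element above q is already 0 at p, by the maximality of [p, q], so [lam] kills its images. *)
have AU' (j i : 'I_N) y : (i <= j)%N -> y \in U' j -> A j i y \in U' i.
  move=> ij /U'P[Uy lam0]; apply/U'P; split=> [|/andP[pi iq]]; first exact: AU.
  rewrite A_comp //; have [jq|qj] := leqP j q.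
    by apply: lam0; rewrite jq (leq_trans pi).
  rewrite max_len ?(leq_trans pi) //; first by rewrite linear0.
  by rewrite ltn_sub2r // (leq_ltn_trans pq).
have scale1 (a : k) : a *: (1 : k^o) = a by exact: mulr1.
have [I [p' [q' [x [Ux x0 Ax span_x free_x]]]]] := IH U' dimU' AU'.
pose x1 (j : 'I_N) : D j := if (p <= j <= q)%N then A q j v else 0.
have lamx1 (j : 'I_N) : (p <= j <= q)%N -> lam (A j p (x1 j)) = 1.
  by move=> jP; rewrite /x1 jP; case/andP: jP => pj jq; rewrite A_comp.
exists (option I), (oapp p' p), (oapp q' q), (oapp x x1); split.
- case=> [a|] j /=; first exact: subvP (U'U j) _ (Ux a j).
  by rewrite /x1; case: ifP => [/andP[_ jq]|_]; [apply: AU | apply: mem0v].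
- by case=> [a|] j /=; [apply: x0 | rewrite /x1 => /negPf ->].
- case=> [a|] j i ij /=; first exact: Ax.
  rewrite /x1 => jP; rewrite jP; case/andP: jP => pj jq.
  (* Below p the section vanishes: surviving there would give a longer interval. *)
  rewrite A_comp // (leq_trans ij jq) andbT; case: leqP => // ip.
  by apply: max_len; rewrite ?(leq_trans ij) // ltn_sub2l // (leq_trans ip).
- move=> j y Uy; have [jP|jP] := boolP (p <= j <= q)%N.
    have /span_x[c yE] : y - lam (A j p y) *: x1 j \in U' j.
      apply/U'P; split=> [|_].
        rewrite rpredB ?rpredZ // /x1 jP; case/andP: jP => pj jq; exact: AU.
      by rewrite !(linearB, linearZ) /= lamx1 // scalerN scale1 subrr.
    exists (oapp c (lam (A j p y))).
    by rewrite sum_option -yE addrC subrK.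
  have /span_x[c yE] : y \in U' j by apply/U'P; split=> // jP'; rewrite jP' in jP.
  exists (oapp c 0).
  by rewrite sum_option scale0r add0r.
- move=> j c; rewrite sum_option => c0.
  (* Applying [lam] at p isolates the coefficient of [x1], because the other sections lie in
     [U']. *)
  have cN : (p <= j <= q)%N -> c None = 0.
    move=> jP; have := congr1 (fun y => lam (A j p y)) c0.
    rewrite !(linearD, linearZ, linear0, linear_sum) /= lamx1 // scale1 big1.
      by rewrite addr0.
    move=> a _; rewrite !linearZ /=.
    by case/U'P: (Ux a j) => _ ->; rewrite ?mulr0.
  have {}c0 : \sum_a c (Some a) *: x a j = 0.
    rewrite -[RHS]c0; have [jP|/negPf jP] := boolP (p <= j <= q)%N.
      by rewrite cN // scale0r add0r.
    by rewrite /= /x1 jP scaler0 add0r.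
  by case=> [a|]; [apply: free_x c0 a | apply: cN].
Qed.
End ChainDecomposition.

(** * Barcodes and sections *)

Section Frame.
Variable k : fieldType.

Section Functor.
Variables (T : Type) (le : rel T) (V : T -> lmodType k).
Variable A : forall t s, le s t -> {linear V t -> V s}.

(* A decomposition into interval modules, presented by one section x a per interval
   module, which vanishes where a is not alive. *)
Record frame (I : finType) (alive : I -> T -> bool) (x : I -> forall t, V t) : Prop := Frame {
  frame_dead : forall a t, ~~ alive a t -> x a t = 0;
  frame_map : forall a t s (st : le s t), alive a t -> A st (x a t) = x a s;
  frame_span : forall t y, exists c : I -> k, y = \sum_a c a *: x a t;
  frame_free : forall t (c : I -> k), \sum_a c a *: x a t = 0 ->
    forall a, alive a t -> c a = 0
}.

(** Sections that are never alive vanish, so spans and relations involve only indices in the image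
    of h. This discards the empty bars. *)
Lemma frame_reindex (I J : finType) (h : J -> I) (alive : I -> T -> bool) (x : I -> forall t, V t) :
  injective h -> (forall a t, alive a t -> a \in codom h) ->
  frame alive x -> frame (fun b => alive (h b)) (fun b => x (h b)).
Proof.
move=> inj_h cod_h F.
have sumE t (c : I -> k) : \sum_a c a *: x a t = \sum_b c (h b) *: x (h b) t.
  rewrite (bigID (mem (codom h))) /= [X in _ + X]big1 ?addr0; last first.
    move=> a ah; rewrite (frame_dead F) ?scaler0 //.
    by apply: contra ah => /cod_h.
  rewrite -[LHS]big_filter.
  have -> : \sum_b c (h b) *: x (h b) t = \sum_(a <- codom h) c a *: x a t.
    by rewrite /image_mem big_map big_enum.
  apply: perm_big; apply: uniq_perm; rewrite ?filter_uniq ?index_enum_uniq //.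
    by rewrite map_inj_uniq ?enum_uniq.
  by move=> a; rewrite mem_filter mem_index_enum andbT.
split=> [a t|a t s st|t y|t c c0 b bt].
- exact: frame_dead F (h a) t.
- exact: (frame_map F (a := h a)).
- by have [c ->] := frame_span F y; exists (c \o h); rewrite sumE.
pose c' a := if [pick b | h b == a] is Some b then c b else 0.
have c'h b' : c' (h b') = c b'.
  by rewrite /c'; case: pickP => [b'' /eqP /inj_h -> //|/(_ b')]; rewrite eqxx.
rewrite -c'h; apply: (frame_free F (t := t)) => //; rewrite sumE -[RHS]c0.
by apply: eq_bigr => a _; rewrite c'h.
Qed.
End Functor.

(** Turns a frame over positions in a chain into one over real parameters; [theta] absorbs the
    identification of the spaces. *)
Lemma frame_pullback (T T' : Type) (le : rel T) (le' : rel T')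
    (V : T -> lmodType k) (V' : T' -> lmodType k)
    (A : forall t s, le s t -> {linear V t -> V s})
    (A' : forall t s, le' s t -> {linear V' t -> V' s})
    (rho : T' -> T) (rho_mono : forall t s, le' s t -> le (rho s) (rho t))
    (theta : forall t, {linear V (rho t) -> V' t})
    (I : finType) (alive : I -> T -> bool) (x : I -> forall t, V t) :
  (forall t, bijective (theta t)) ->
  (forall t s (st : le' s t) y, A' t s st (theta t y) = theta s (A _ _ (rho_mono t s st) y)) ->
  frame A alive x ->
  frame A' (fun a t => alive a (rho t)) (fun a t => theta t (x a (rho t))).
Proof.
move=> theta_bij theta_nat F.
have sumE t (c : I -> k) : \sum_a c a *: theta t (x a (rho t)) =
    theta t (\sum_a c a *: x a (rho t)).
  by rewrite linear_sum; apply: eq_bigr => a _; rewrite linearZ.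
split=> [a t /(frame_dead F) ->|a t s st al|t y|t c c0].
- exact: linear0.
- by rewrite theta_nat (frame_map F).
- have [theta' _ thetaK] := theta_bij t.
  have [c yE] := frame_span F (theta' y); exists c.
  by rewrite sumE -yE thetaK.
apply: (frame_free F); apply: (bij_inj (theta_bij t)).
by rewrite -sumE c0 linear0.
Qed.

(** The sections alive at both s and t form a basis of the image of the map from t to s, so both
    sides are its rank. *)
Lemma frame_card (T : Type) (le : rel T) (V : T -> lmodType k)
    (A : forall t s, le s t -> {linear V t -> V s})
    (I J : finType) (alive : I -> T -> bool) (alive' : J -> T -> bool)
    (x : I -> forall t, V t) (x' : J -> forall t, V t) t s :
  le s t -> frame A alive x -> frame A alive' x' ->
  (#|[set a | alive a s && alive a t]%SET| <= #|[set b | alive' b s && alive' b t]%SET|)%N.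
Proof.
move=> st F F'.
pose g a b := projT1 (cid (frame_span F' (x a t))) b.
have gE a : x a t = \sum_b g a b *: x' b t by rewrite /g; case: (cid _).
apply: (@free_card_le _ _ _ _ _ _ (fun a => x a s) (fun b => x' b s) g) => [c c0 a aP|a].
  pose c' a := if a \in [set a | alive a s && alive a t]%SET then c a else 0.
  have -> : c a = c' a by rewrite /c' aP.
  apply: (frame_free F (t := s)); last by move: aP; rewrite inE => /andP[].
  rewrite -[RHS]c0 [RHS]big_mkcond; apply: eq_bigr => b _.
  by rewrite /c'; case: ifP; rewrite ?scale0r.
rewrite inE => /andP[al_s al_t]; rewrite -(frame_map F st al_t) gE linear_sum.
rewrite [RHS]big_mkcond; apply: eq_bigr => b _; rewrite linearZ /= inE.
have [bt|bt] := boolP (alive' b t); last by rewrite andbF (frame_dead F' bt) linear0 scaler0.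
rewrite andbT (frame_map F' st bt).
by have [//|bs] := boolP (alive' b s); rewrite (frame_dead F' bs) scaler0.
Qed.
End Frame.

Lemma prodm_sumE (A : nzRingType) (J : Type) (U : J -> lmodType A) (I : finType)
    (F : I -> prodm U) j :
  (\sum_a F a) j = \sum_a F a j.
Proof. by apply: (big_morph (fun u : prodm U => u j)). Qed.

Section BarcodeFrame.
Variables (R : realType) (k : fieldType) (V : pmodule R k).

Definition barcode_frame (I : finType) (J : I -> interval R) (x : I -> forall t, V t) :=
  frame (le := fun s t => s <= t) (@Defs.pmap R k V) (fun a t => t \in J a) x.

Lemma row_dead (b : bool) (u v : 'rV[k]_b) : ~~ b -> u = v.
Proof. by case: b u v => // u v _; rewrite !thinmx0. Qed.

(** Summing the entries reads the only coordinate without an index in ['I_b], whose existence would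
    depend on b. *)
Lemma row_alive (b : bool) (u : 'rV[k]_b) : b -> u = const_mx (\sum_l u 0 l).
Proof.
by case: b u => // u _; apply/rowP => l; rewrite mxE big_ord1 ord1.
Qed.

Lemma sum_const (b : bool) (a : k) : b -> \sum_l (const_mx a : 'rV_b) 0 l = a.
Proof. by case: b => // _; rewrite big_ord1 mxE. Qed.

Lemma const_mul_ones (b c : bool) (a : k) :
  (const_mx a : 'rV_b) *m (const_mx 1 : 'M_(b, c)) = const_mx (if b then a else 0).
Proof.
by case: b; apply/rowP => l; rewrite !mxE ?big_ord0 ?big_ord1 ?mxE ?mulr1.
Qed.

Section FrameBarcode.
Variables (B : seq (interval R)) (x : 'I_(size B) -> forall t, V t).
Hypothesis F : barcode_frame (tnth (in_tuple B)) x.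
Let W : pmodule R k := psum (fun m : 'I_(size B) => interval_module k (tnth (in_tuple B) m)).

(** The coordinate of a dead section is arbitrary; it is harmless in [phi], where the corresponding
    row has length 0. *)
Let coord t y m : k := projT1 (cid (frame_span F (t := t) y)) m.

Let coordE t y : y = \sum_m coord y m *: x m t.
Proof. by rewrite /coord; case: (cid _). Qed.

Let coord_unique t (c : 'I_(size B) -> k) y m : t \in tnth (in_tuple B) m ->
  y = \sum_a c a *: x a t -> coord y m = c m.
Proof.
move=> tm yE; apply/eqP; rewrite -subr_eq0; apply/eqP.
apply: (frame_free F (t := t) (c := fun a => coord y a - c a)) => //.
under eq_bigr do rewrite scalerBl.
by rewrite sumrB -coordE -yE subrr.
Qed.

Let phi t (y : V t) : W t := fun m => const_mx (coord y m).

Let phi_linear t : linear (@phi t).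
Proof.
move=> a y z; apply: prodmP => m; rewrite prodmPE.
have /orP[tm|/row_dead tm] := orbN (t \in tnth (in_tuple B) m); last exact: tm.
apply/rowP => l; rewrite !mxE.
apply: (coord_unique (c := fun b => a * coord y b + coord z b)) => //.
under eq_bigr do rewrite scalerDl -scalerA.
by rewrite big_split -scaler_sumr -!coordE.
Qed.
HB.instance Definition _ t := GRing.isLinear.Build k (V t) (W t) _ (@phi t) (@phi_linear t).

Let psi t (w : W t) : V t := \sum_m (\sum_l (w m : 'rV_(t \in tnth (in_tuple B) m)) 0 l) *: x m t.

Let phi_bij t : bijective (@phi t).
Proof.
exists (@psi t) => [y|w].
  rewrite [RHS]coordE; apply: eq_bigr => m _.
  have /orP[tm|/(frame_dead F) ->] := orbN (t \in tnth (in_tuple B) m); last by rewrite !scaler0.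
  by rewrite [X in X *: _](@sum_const _ (coord y m) tm).
apply: prodmP => m.
have /orP[tm|/row_dead tm] := orbN (t \in tnth (in_tuple B) m); last exact: tm.
by rewrite [RHS]row_alive // /phi (coord_unique tm erefl).
Qed.

Lemma frame_pmodule_iso : pmodule_iso V W.
Proof.
exists (fun t => @phi t : {linear V t -> W t}); split=> [t|t s st y]; first exact: phi_bij.
apply: prodmP => m.
have /orP[sm|/row_dead sm] := orbN (s \in tnth (in_tuple B) m); last exact: sm.
rewrite [RHS](const_mul_ones _ _ (coord y m)).
rewrite -[LHS]/(const_mx (coord (Defs.pmap V st y) m) : 'rV_(s \in tnth (in_tuple B) m)).
(* A section dead at t may be alive at s, where its arbitrary coordinate would matter; it is
   replaced by 0. *)
rewrite (coord_unique (c := fun a => if t \in tnth (in_tuple B) a then coord y a else 0) sm).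
  by [].
rewrite [in LHS](coordE y) linear_sum; apply: eq_bigr => a _; rewrite linearZ /=.
have [ta|ta] := boolP (t \in tnth (in_tuple B) a); first by rewrite (frame_map F st).
by rewrite (frame_dead F ta) linear0 scale0r scaler0.
Qed.
End FrameBarcode.

Lemma frame_is_barcode (I : finType) (J : I -> interval R) (x : I -> forall t, V t)
    (P : pred I) :
  (forall a, P a = `[< exists t, t \in J a >]) -> barcode_frame J x ->
  is_barcode V [seq J a | a <- enum I & P a].
Proof.
move=> PE F; set e := [seq a <- enum I | P a].
have eP a : a \in e = P a by rewrite mem_filter mem_enum andbT.
split=> [_ /mapP[a + ->]|]; first by rewrite eP PE => /asboolP.
pose h (m : 'I_(size (map J e))) := tnth (in_tuple e) (cast_ord (size_map J e) m).
have hJ m : tnth (in_tuple (map J e)) m = J (h m).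
  rewrite (tnth_nth (J (h m))) /= (nth_map (h m)) -?(size_map J e) //.
  by rewrite {2}/h (tnth_nth (h m)).
have h_inj : injective h.
  move=> m m' /eqP; rewrite /h /tnth /=.
  rewrite (set_nth_default (tnth_default (in_tuple e) (cast_ord (size_map J e) m))) -?(size_map J e) //=.
  rewrite nth_uniq -?(size_map J e) //; first by move/eqP/val_inj.
  by rewrite filter_uniq ?enum_uniq.
apply: (@frame_pmodule_iso (map J e) (fun m => x (h m)) _).
have := frame_reindex h_inj _ F; rewrite /barcode_frame.
have -> : (fun a t => t \in tnth (in_tuple [seq J a0 | a0 <- e]) a) =
  ((fun a t => t \in J a) \o h).
  by apply/funext => m; apply/funext => t; rewrite hJ.
apply=> a t ta; have : a \in e by rewrite eP PE; apply/asboolP; exists t.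
rewrite -[a \in e]/(a \in in_tuple e) => /tnthP[m ->]; apply/codomP; exists (cast_ord (esym (size_map J e)) m).
by rewrite /h cast_ordKV.
Qed.

Lemma is_barcode_frame B : is_barcode V B ->
  exists x, barcode_frame (tnth (in_tuple B)) x.
Proof.
move=> [_ [phi [phi_bij phi_nat]]].
pose u t m : psum (fun m : 'I_(size B) => interval_module k (tnth (in_tuple B) m)) t :=
  fun m' => if m' == m then const_mx 1 else 0.
have uS t m : exists y, phi t y = u t m.
  by have [psi _ psiK] := phi_bij t; exists (psi (u t m)).
pose x m t := projT1 (cid (uS t m)).
have xE m t : phi t (x m t) = u t m by rewrite /x; case: (cid _).
have sumE t (c : 'I_(size B) -> k) m :
    phi t (\sum_a c a *: x a t) m = c m *: (const_mx 1 : 'rV_(t \in tnth (in_tuple B) m)).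
  rewrite linear_sum prodm_sumE (bigD1 m) //= big1 ?addr0.
    by rewrite linearZ /= xE /= -[(_ *: u t m) m]/(_ *: u t m m) /u eqxx.
  move=> a am; rewrite linearZ /= xE -[(_ *: u t a) m]/(_ *: u t a m) /u eq_sym.
  by rewrite (negPf am) scaler0.
exists x; split=> [m t tm|m t s st tm|t y|t c c0 m tm].
- apply: (bij_inj (phi_bij t)); rewrite xE linear0; apply: prodmP => m'.
  by rewrite /u; case: eqP => // ->; apply: row_dead.
- apply: (bij_inj (phi_bij s)); rewrite phi_nat !xE; apply: prodmP => m'.
  rewrite /= /prodm_map /= /kint_map /= /u; case: eqP => [->|_]; last by rewrite mul0mx.
  by rewrite (@ones_mul k true) // /= tm implybT.
- exists (fun m => \sum_l (phi t y m : 'rV_(t \in tnth (in_tuple B) m)) 0 l).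
  apply: (bij_inj (phi_bij t)); apply: prodmP => m; rewrite sumE.
  have /orP[tm|/row_dead tm] := orbN (t \in tnth (in_tuple B) m); last exact: tm.
  rewrite [LHS]row_alive //; apply/rowP => l; by rewrite !mxE mulr1.
have := congr1 (fun w => phi t w m) c0; rewrite sumE linear0.
move=> /(congr1 (fun w : 'rV[k]_(t \in tnth (in_tuple B) m) => \sum_l w 0 l)).
under eq_bigr do rewrite mxE.
rewrite -mulr_sumr (sum_const 1 tm) mulr1 => ->.
by apply: big1 => l _; rewrite mxE.
Qed.
End BarcodeFrame.

(** * Uniqueness of barcodes and partial matchings *)

Section Intervals.
Variable R : realType.
Implicit Types (J : interval R) (b : itv_bound R).

(** Since x <= y, the witness inherits from y the condition at the upper end of the interval. It is
    a midpoint, a common endpoint, or a unit step towards an infinite bound. *)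
Lemma lower_bound_between b b' (y : R) : (b < b')%O -> (b' <= BLeft y)%O ->
  exists x, [/\ x <= y, (b <= BLeft x)%O & ~~ (b' <= BLeft x)%O].
Proof.
case: b => [c x|[]]; case: b' => [c' x'|[]] //.
  have [xx'|x'x|<-] := ltgtP x x'.
  - move=> _ x'y; exists ((x + x') / 2).
    by case: c c' x'y => [] []; rewrite !bnd_simp -?ltNge => x'y; split; lra.
  - by case: c c' => [] []; rewrite !bnd_simp; lra.
  by case: c c' => [] []; rewrite !bnd_simp // => _ xy; exists x; rewrite !bnd_simp; split; lra.
by move=> _ x'y; exists (x' - 1); case: c' x'y => []; rewrite !bnd_simp -?ltNge => x'y; split; lra.
Qed.

Lemma upper_bound_between b b' (y : R) : (b < b')%O -> (BRight y <= b)%O ->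
  exists x, [/\ y <= x, (BRight x <= b')%O & ~~ (BRight x <= b)%O].
Proof.
case: b => [c x|[]]; case: b' => [c' x'|[]] //.
  have [xx'|x'x|<-] := ltgtP x x'.
  - move=> _ yx; exists ((x + x') / 2).
    by case: c c' yx => [] []; rewrite !bnd_simp -?ltNge => yx; split; lra.
  - by case: c c' => [] []; rewrite !bnd_simp; lra.
  by case: c c' => [] []; rewrite !bnd_simp // => _ xy; exists x; rewrite !bnd_simp; split; lra.
by move=> _ yx; exists (x + 1); case: c yx => []; rewrite !bnd_simp -?ltNge => yx; split; lra.
Qed.

Lemma not_subitv J J' : (exists x, x \in J) -> ~~ (J <= J')%O ->
  exists x, x \in J /\ x \notin J'.
Proof.
case: J J' => [l u] [l' u'] [y yJ]; have [yJ'|] := boolP (y \in Interval l' u'); last by exists y.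
move: yJ yJ'; rewrite !itv_boundlr subitvE negb_and -!ltNge.
move=> /andP[ly yu] /andP[l'y yu'] /orP[ll'|u'u].
  have [x [xy lx l'x]] := lower_bound_between ll' l'y; exists x.
  by rewrite !itv_boundlr lx (negPf l'x) (le_trans _ yu) ?bnd_simp.
have [x [yx xu u'x]] := upper_bound_between u'u yu'; exists x.
by rewrite !itv_boundlr xu (negPf u'x) andbF (le_trans ly) ?bnd_simp.
Qed.

Lemma itv_convex J (x y z : R) : x <= y <= z -> x \in J -> z \in J -> y \in J.
Proof.
case: J => l u /andP[xy yz]; rewrite !itv_boundlr => /andP[lx _] /andP[_ zu].
by rewrite (le_trans lx) ?(le_trans _ zu) ?bnd_simp.
Qed.

(** Stretching [s, t] to one more point of J rules out one more interval that does not contain J;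
    convexity keeps the earlier ones ruled out. *)
Lemma itv_span J (S : seq (interval R)) : (exists x, x \in J) ->
  exists s t, [/\ s <= t, s \in J, t \in J &
    forall J', J' \in S -> s \in J' -> t \in J' -> (J <= J')%O].
Proof.
move=> J0; elim: S => [|J1 S [s [t [st sJ tJ IH]]]].
  by have [x xJ] := J0; exists x, x.
have [JJ1|/(not_subitv J0)[x [xJ xJ1]]] := boolP (J <= J1)%O.
  by exists s, t; split=> // J'; rewrite inE => /predU1P[-> //|]; apply: IH.
exists (Num.min s x), (Num.max t x); split.
- by rewrite ge_min le_max st.
- by case: (leP s x).
- by case: (leP t x).
move=> J'; rewrite inE => /predU1P[->|J'S] sJ' tJ'.
  by case/negP: xJ1; apply: itv_convex sJ' tJ'; rewrite ge_min le_max lexx !orbT.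
by apply: IH J'S _ _; apply: itv_convex sJ' tJ'; rewrite ge_min le_max ?lexx ?st ?orbT.
Qed.

Lemma maximal_itv (S : seq (interval R)) : S != [::] ->
  exists2 J, J \in S & forall J', J' \in S -> (J <= J')%O -> J' = J.
Proof.
elim: S => // J0 [|J1 S] IH _.
  by exists J0 => [|J']; rewrite inE // => /eqP.
have [//|M MS Mmax] := IH; have [MJ|MJ] := boolP (M <= J0)%O.
  exists J0 => [|J']; rewrite inE ?eqxx // => /predU1P[//|J'S] J0J'.
  have J'M := Mmax J' J'S (le_trans MJ J0J').
  by apply/eqP; rewrite eq_le J0J' andbT J'M.
exists M => [|J']; first by rewrite inE MS orbT.
by rewrite inE => /predU1P[->|/Mmax //]; rewrite (negPf MJ).
Qed.

(* An inclusion-maximal interval J is detected by the bars containing two suitable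
   points of J, so its multiplicity is determined by the counts. *)
Lemma perm_eq_of_counts (B C : seq (interval R)) :
  (forall J, J \in B -> exists x, x \in J) -> (forall J, J \in C -> exists x, x \in J) ->
  (forall s t, s <= t -> count (fun J => (s \in J) && (t \in J)) B =
    count (fun J => (s \in J) && (t \in J)) C) ->
  perm_eq B C.
Proof.
have [m] := ubnP (size B + size C)%N.
elim: m B C => // m IH B C; rewrite ltnS => szBC B0 C0 eqBC.
have [BC0|BC0] := eqVneq (B ++ C) [::]; first by case: B C BC0 {IH szBC B0 C0 eqBC} => [] [].
have [J JBC Jmax] := maximal_itv BC0.
have J0 : exists x, x \in J by move: JBC; rewrite mem_cat => /orP[/B0|/C0].
have [s [t [st sJ tJ stJ]]] := itv_span (B ++ C) J0.
have countE S : {subset S <= B ++ C} ->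
    count (fun J' => (s \in J') && (t \in J')) S = count_mem J S.
  move=> SBC; apply: eq_in_count => J' /SBC J'BC /=; apply/idP/eqP => [/andP[sJ' tJ']|-> //].
    by apply: Jmax => //; apply: stJ.
  by rewrite sJ tJ.
have BBC : {subset B <= B ++ C} by move=> x xB; rewrite mem_cat xB.
have CBC : {subset C <= B ++ C} by move=> x xC; rewrite mem_cat xC orbT.
have eqJ := eqBC s t st; rewrite (countE _ BBC) (countE _ CBC) in eqJ.
have [JB JC] : J \in B /\ J \in C.
  by move: JBC; rewrite mem_cat -!has_pred1 !has_count eqJ orbb.
rewrite (permPl (perm_to_rem JB)) perm_sym (permPl (perm_to_rem JC)) perm_cons perm_sym.
apply: IH => [|J' /mem_rem/B0 //|J' /mem_rem/C0 //|s' t' st'].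
  apply: leq_trans szBC; rewrite (perm_size (perm_to_rem JB)) (perm_size (perm_to_rem JC)) /=.
  by rewrite addSn addnS leqW.
have := eqBC s' t' st'.
rewrite (permP (perm_to_rem JB)) (permP (perm_to_rem JC)) /=.
by move/addnI.
Qed.
End Intervals.

Section Uniqueness.
Variables (R : realType) (k : fieldType) (V : pmodule R k).

Lemma card_tnth (T : Type) (P : pred T) (B : seq T) :
  #|[set m : 'I_(size B) | P (tnth (in_tuple B) m)]%SET| = count P B.
Proof. by rewrite -sum1_count big_tnth sum1dep_card. Qed.

(** The number of bars containing both s and t is the rank of the structure map from t to s, which
    does not depend on the barcode. *)
Lemma is_barcode_perm (B C : seq (interval R)) :
  is_barcode V B -> is_barcode V C -> perm_eq B C.
Proof.
move=> VB VC; have [x Fx] := is_barcode_frame VB; have [y Fy] := is_barcode_frame VC.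
apply: perm_eq_of_counts; [exact: VB.1 | exact: VC.1 | move=> s t st].
rewrite -!card_tnth; apply/eqP; rewrite eqn_leq.
by apply/andP; split; [apply: frame_card Fx Fy | apply: frame_card Fy Fx].
Qed.
End Uniqueness.

(** * Composition of partial matchings of bounded cost *)

Section Matching.
Variable R : realType.
Implicit Types (B C D : seq (interval R)) (J : interval R).

Definition itv0 : interval R := Interval (BInfty _ true) (BInfty _ true).

(** Positions are natural numbers, so that extending and composing matchings needs no casts between
    ordinals; [bottleneck_le] returns to finite functions. *)
Definition matched (d : R) B C : Prop := exists m : nat -> option nat,
  [/\ forall i, (i < size B)%N ->
        if m i is Some j then (j < size C)%N /\ (bar_dist (nth itv0 B i) (nth itv0 C j) <= d%:E)%E
        else (diag_dist (nth itv0 B i) <= d%:E)%E,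
      forall i i', (i < size B)%N -> (i' < size B)%N -> m i <> None -> m i = m i' -> i = i'
    & forall j, (j < size C)%N -> (forall i, (i < size B)%N -> m i <> Some j) ->
        (diag_dist (nth itv0 C j) <= d%:E)%E].

Lemma matched_nil d : matched d [::] [::].
Proof. by exists (fun=> None). Qed.

Lemma matched_cons d J J' B C : (bar_dist J J' <= d%:E)%E -> matched d B C ->
  matched d (J :: B) (J' :: C).
Proof.
move=> JJ' [m [mB minj mC]].
exists (fun i => if i is i'.+1 then omap S (m i') else Some 0%N); split.
- case=> [|i] //= /mB; by case: (m i).
- case=> [|i] [|i'] //= iB i'B; first by case: (m i').
    by case: (m i).
  move=> mi0 mii'; congr S; apply: minj => //; first by case: (m i) mi0.
  by case: (m i) (m i') mii' => [?|] [?|] //= [->].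
case=> [|j] /= jC mj; first by have := mj 0%N isT.
by apply: mC => // i iB mi; apply: (mj i.+1) => //=; rewrite mi.
Qed.

Lemma matched_consl d J B C : (diag_dist J <= d%:E)%E -> matched d B C ->
  matched d (J :: B) C.
Proof.
move=> Jd [m [mB minj mC]].
exists (fun i => if i is i'.+1 then m i' else None); split.
- by case=> [|i] //= /mB.
- by case=> [|i] [|i'] //= iB i'B mi mii'; congr S; apply: minj.
by move=> j jC mj; apply: mC => // i iB; apply: (mj i.+1).
Qed.

Lemma matched_consr d J B C : (diag_dist J <= d%:E)%E -> matched d B C ->
  matched d B (J :: C).
Proof.
move=> Jd [m [mB minj mC]].
exists (fun i => omap S (m i)); split.
- by move=> i /mB /=; case: (m i).
- move=> i i' iB i'B mi0 mii'; apply: minj => //; first by case: (m i) mi0.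
  by case: (m i) (m i') mii' => [?|] [?|] //= [->].
case=> [|j] //= jC mj.
by apply: mC => // i iB mi; apply: (mj i) => //=; rewrite mi.
Qed.

(** An infinite endpoint is at distance +oo from every other one, which reduces the later estimates
    to real arithmetic. *)
Lemma endpoint_dist_fin (x y : \bar R) (d : R) : (endpoint_dist x y <= d%:E)%E ->
  (x = y /\ forall r, x <> r%:E) \/
  exists r s : R, [/\ x = r%:E, y = s%:E & `|r - s| <= d].
Proof.
rewrite /endpoint_dist; case: x y => [r| |] [s| |] //=.
- case: eqP => [[->]|_] /=; first by rewrite lee_fin => d0; right; exists s, s; rewrite subrr normr0.
  by rewrite lee_fin => rs; right; exists r, s.
all: by move=> _; left.
Qed.

Lemma endpoint_dist_le (r s d : R) : `|r - s| <= d -> (endpoint_dist r%:E s%:E <= d%:E)%E.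
Proof.
rewrite /endpoint_dist; case: eqP => // _ rs; rewrite lee_fin; exact: le_trans rs.
Qed.

Lemma endpoint_dist_trans (x y z : \bar R) (d e : R) : 0 <= d -> 0 <= e ->
  (endpoint_dist x y <= d%:E)%E -> (endpoint_dist y z <= e%:E)%E ->
  (endpoint_dist x z <= (d + e)%:E)%E.
Proof.
move=> d0 e0 /endpoint_dist_fin[[<- _] xz|[r [s [-> -> rs]]]].
  by apply: le_trans xz _; rewrite lee_fin; lra.
move=> /endpoint_dist_fin[[_ /(_ s)]//|[s' [t [[<-] -> st]]]].
apply: endpoint_dist_le; have := ler_distD s r t; lra.
Qed.

Lemma bar_dist_trans J1 J2 J3 (d e : R) : 0 <= d -> 0 <= e ->
  (bar_dist J1 J2 <= d%:E)%E -> (bar_dist J2 J3 <= e%:E)%E ->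
  (bar_dist J1 J3 <= (d + e)%:E)%E.
Proof.
rewrite /bar_dist !ge_max => d0 e0 /andP[l12 u12] /andP[l23 u23].
by apply/andP; split; apply: endpoint_dist_trans; eassumption.
Qed.

(** Half the length changes by at most d when each endpoint moves by at most d; infinite endpoints
    do not move at all. *)
Lemma diag_dist_near J1 J2 (d e : R) : 0 <= d -> 0 <= e ->
  (bar_dist J1 J2 <= d%:E)%E -> (diag_dist J2 <= e%:E)%E ->
  (diag_dist J1 <= (d + e)%:E)%E.
Proof.
rewrite /bar_dist ge_max /diag_dist => d0 e0 /andP[].
move: (lower_end J1) (lower_end J2) (upper_end J1) (upper_end J2) => l1 l2 u1 u2.
move=> /endpoint_dist_fin[[<- lN]|[a [b [-> -> ab]]]];
  move=> /endpoint_dist_fin[[<- uN]|[a' [b' [-> -> ab']]]].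
- by move/le_trans; apply; rewrite lee_fin; lra.
- by case: l1 lN => [r /(_ r)//| |] _ //=; move/le_trans; apply; rewrite lee_fin; lra.
- by case: u1 uN => [r /(_ r)//| |] _ //=; move/le_trans; apply; rewrite lee_fin; lra.
by rewrite -!EFinB -!EFinM !lee_fin; move: ab ab'; rewrite !ler_norml => /andP[? ?] /andP[? ?]; lra.
Qed.

Lemma bar_dist_sym J1 J2 : bar_dist J1 J2 = bar_dist J2 J1.
Proof.
have sym (x y : \bar R) : endpoint_dist x y = endpoint_dist y x.
  rewrite /endpoint_dist eq_sym; case: eqP => // _.
  by case: x y => [r| |] [s| |] //=; rewrite distrC.
by rewrite /bar_dist !(sym _ (lower_end J2)) !(sym _ (upper_end J2)).
Qed.

Lemma matched_trans B C D (d e : R) : 0 <= d -> 0 <= e ->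
  matched d B C -> matched e C D -> matched (d + e) B D.
Proof.
move=> d0 e0 [m [mB minj mC]] [n [nC ninj nD]].
exists (fun i => obind n (m i)); split.
- move=> i /mB; case: (m i) => [j [/nC]|] /=; last first.
    by move/le_trans; apply; rewrite lee_fin; lra.
  case: (n j) => [l [lD jl] ij|jd ij]; last exact: diag_dist_near jd.
  by split=> //; apply: bar_dist_trans ij jl.
- move=> i i' iB i'B; have := mB i iB; have := mB i' i'B; have := minj i i' iB i'B.
  case: (m i) (m i') => [j|] [j'|] //= mii' [j'C _] [jC _] nj0 njj'; apply: mii' => //; congr Some.
  exact: ninj njj'.
(* If l has a partner j in C, then m does not reach j, so the half-length of j is at most d, and l
   lies within e of j. *)
move=> l lD nl; have [[j jC njl]|nomatch] := pselect (exists2 j, (j < size C)%N & n j = Some l).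
  have := nC j jC; rewrite njl => -[_ jl]; rewrite addrC.
  apply: (@diag_dist_near _ (nth itv0 C j)); rewrite // 1?bar_dist_sym //.
  by apply: mC => // i iB mi; apply: (nl i) => //=; rewrite mi.
apply: (@le_trans _ _ e%:E); last by rewrite lee_fin; lra.
by apply: nD => // j jC njl; apply: nomatch; exists j.
Qed.

Lemma endpoint_dist_refl (x : \bar R) (d : R) : 0 <= d -> (endpoint_dist x x <= d%:E)%E.
Proof. by rewrite /endpoint_dist eqxx lee_fin. Qed.

Lemma matched_perm d B C : 0 <= d -> perm_eq B C -> matched d B C.
Proof.
move=> d0 /(perm_iotaP itv0)[Is Is_iota ->]; set m := fun i => Some (nth 0%N Is i).
have szI : size Is = size C by rewrite (perm_size Is_iota) size_iota.
have uI : uniq Is by rewrite (perm_uniq Is_iota) iota_uniq.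
have IsP j : (j \in Is) = (j < size C)%N by rewrite (perm_mem Is_iota) mem_iota.
exists m; rewrite size_map; split.
- move=> i iI; split; first by rewrite -IsP mem_nth.
  by rewrite (nth_map 0%N) // /bar_dist ge_max !endpoint_dist_refl.
- by move=> i i' iI i'I _ [/eqP]; rewrite nth_uniq // => /eqP.
move=> j; rewrite -IsP => jI /(_ (index j Is)).
by rewrite index_mem => /(_ jI) []; rewrite /m nth_index.
Qed.

Lemma bottleneck_le d B C : 0 <= d -> matched d B C -> (bottleneck B C <= d%:E)%E.
Proof.
move=> d0 [m [mB minj mC]].
(* [insub] would turn an out-of-range value into None; [mB] excludes such values, whence [fN]. *)
pose f : {ffun 'I_(size B) -> option 'I_(size C)} := [ffun i : 'I__ => obind insub (m i)].
have fP (i : 'I_(size B)) j : f i = Some j <-> m i = Some (val j).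
  rewrite ffunE; case: (m i) => [j'|] //=; split=> [|[->]]; last by rewrite valK.
  by case: insubP => // j'' _ <- [->].
have fN (i : 'I_(size B)) : f i = None -> m i = None.
  rewrite ffunE; have := mB i (ltn_ord i); case: (m i) => [j'|] //= [j'C _].
  by rewrite insubT.
have cost : (matching_cost f <= d%:E)%E.
  rewrite /matching_cost ge_max; apply/andP; split; elim/big_ind: _ => //=.
  - by move=> x y xd yd; rewrite ge_max xd.
  - move=> i _; have := mB i (ltn_ord i); rewrite !(tnth_nth itv0) /=.
    case fi : (f i) => [j|]; last by rewrite (fN _ fi).
    by rewrite (fP i j).1 // (tnth_nth itv0) => -[].
  - by move=> x y xd yd; rewrite ge_max xd.
  move=> j /forallP nj; rewrite (tnth_nth itv0); apply: mC => // i iB mi.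
  by have /eqP := nj (Ordinal iB); apply; apply/fP.
apply: le_trans cost; rewrite /bottleneck; apply: (bigmin_le_cond _ (j := f)).
apply/forallP => i; apply/forallP => i'; apply/implyP => /andP[/eqP fii' fi].
apply/eqP/val_inj; apply: minj => //=; first by move=> /esym mi; case fE: (f i) fi mi => [j|//] _; rewrite (fP i j).1.
by case fE: (f i) fi => [j|//] _; rewrite (fP i j).1 // (fP i' j).1 // -fii'.
Qed.
End Matching.

(** * Finite dimensionality of graded local cohomology *)

Section LocalCohomologyDim.
Variables (k : fieldType) (n : nat).
Local Notation S := (mpoly n k).

Lemma mnm_multideg_inj : injective (@mnm_multideg n).
Proof.
move=> m m' /ffunP e; apply/mnmP => j.
by have := e j; rewrite !ffunE => -[].
Qed.

(** Each multidegree contains at most one monomial. *)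
Lemma homog_proportional (beta : multideg n) (p p' : S) :
  p \in homog beta -> p' \in homog beta -> p != 0 -> exists c, p' = mpolyC n c * p.
Proof.
move=> /allP hp /allP hp'; rewrite -msupp_eq0.
case E: (msupp p) => [//|m s] _.
have mp : m \in msupp p by rewrite E inE eqxx.
have mE (r : S) m' : {in msupp r, forall m, mnm_multideg m == beta} ->
    m' != m -> mcoeff m' r = 0.
  move=> hr; apply: contraNeq; rewrite -mcoeff_msupp => /hr /eqP e.
  by apply/eqP/mnm_multideg_inj; rewrite e (eqP (hp m mp)).
exists (mcoeff m p' / mcoeff m p); apply/mpolyP => m'; rewrite mcoeffCM.
have [->|m'm] := eqVneq m' m; last by rewrite (mE _ _ hp m'm) (mE _ _ hp' m'm) mulr0.
by rewrite divfK -?mcoeff_msupp.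
Qed.

Variables (P : {set 'I_n}) (Gamma : {set {set 'I_n}}) (q : nat) (alpha : multideg n).
Local Notation M := (sr_module k Gamma).

(** Over a common denominator, two elements of one degree have numerators of equal multidegree,
    hence proportional. Any nonzero element serves as e. *)
Lemma loc_comp_line (F : {set 'I_n}) : exists2 e : loc M (varprod k F),
  e \in loc_comp alpha & forall u, u \in loc_comp (M := M) (F := F) alpha ->
    exists c, u = mpolyC n c *: e.
Proof.
have [[e [he e0]]|all0] :=
  pselect (exists e, e \in loc_comp (M := M) (F := F) alpha /\ e != 0); last first.
  exists 0; first exact: loc_comp0.
  move=> u hu; exists 0; rewrite scaler0; apply: contrapT => /eqP u0.
  by apply: all0; exists u.
exists e => // u /asboolP[m [a [/asboolP[p hp ->] ->]]].
move: e0; have /asboolP[m' [b [/asboolP[p' hp' ->] ->]]] := he => e0.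
set x := varprod k F in e0 *.
have hX d := homogX d (homog_varprod k F).
pose p1 : S := x ^+ b * p; pose p1' : S := x ^+ a * p'.
have h1 : p1 \in homog (alpha + indic F *+ (a + b)).
  by rewrite mulrnDr addrA addrC homogM.
have h1' : p1' \in homog (alpha + indic F *+ (a + b)).
  by rewrite addnC mulrnDr addrA addrC homogM.
pose fr (r : S) d : loc M x := Defs.frac x (quotm_pi (sr_ideal Gamma) r : M) d.
have frX (r : S) d d' : fr (x ^+ d * r) (d + d')%N = fr r d'.
  rewrite /fr -[RHS](fracX x d); congr (Defs.frac x _ _).
  exact: esym (quotm_scaleE (sr_ideal Gamma) _ _).
have uE : fr p a = fr p1 (b + a)%N by rewrite -(frX p b).
have eE : fr p' b = fr p1' (b + a)%N by rewrite addnC -(frX p' a).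
rewrite -[Defs.frac _ _ b]/(fr p' b) -[Defs.frac _ _ a]/(fr p a) in e0 *.
have p1'0 : p1' != 0 by apply: contraNneq e0 => p0; rewrite eE p0 /fr linear0 frac0.
have [c p1E] := homog_proportional h1' h1 p1'0; exists c.
rewrite uE eE /fr fracZ p1E; congr (Defs.frac x _ _).
exact: esym (quotm_scaleE (sr_ideal Gamma) _ _).
Qed.

(** A homogeneous cocycle is given by one scalar for each localization. More classes than
    localizations force a relation among representatives, hence among the classes. *)
Lemma lcoh_deg_dim : dim_le (lcoh_deg P M q alpha) #|{set 'I_n}|.
Proof.
move=> I v indep_v; rewrite leqNgt; apply/negP => big.
pose e F := s2val (cid2 (loc_comp_line F)).
have eS F u : u \in loc_comp (M := M) (F := F) alpha -> exists c, u = mpolyC n c *: e F.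
  exact: (s2valP' (cid2 (loc_comp_line F))).
have zP a : exists z : subm (cocycle P (M := M) q),
    (forall F, val z F \in loc_comp alpha) /\ val (v a) = quotm_pi (@coboundary k n P M q) z.
  by have /asboolP := valP (v a).
pose z a := projT1 (cid (zP a)).
have zE a : (forall F, val (z a) F \in loc_comp alpha) /\ val (v a) = quotm_pi (@coboundary k n P M q) (z a).
  by rewrite /z; case: (cid _).
pose g a F := projT1 (cid (eS F _ ((zE a).1 F))).
have gE a F : val (z a) F = mpolyC n (g a F) *: e F by rewrite /g; case: (cid _).
have := @underdetermined k I {set 'I_n} finset.setT finset.setT g.
rewrite !cardsT => /(_ big)[c [[b _ cb] cg]].
case/eqP: cb; apply: indep_v; apply: val_inj.
pose Z : subm (cocycle P (M := M) q) := \sum_a mpolyC n (c a) *: z a.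
transitivity (quotm_pi (@coboundary k n P M q) Z).
  rewrite /Z linear_sum raddf_sum; apply: eq_bigr => a _.
  rewrite linearZ /= (zE a).2.
  exact: quotm_scaleE.
suff -> : Z = 0 by rewrite linear0.
apply: val_inj; apply: prodmP => F; rewrite /Z raddf_sum prodm_sumE.
transitivity (mpolyC n (\sum_a c a * g a F) *: e F).
  rewrite raddf_sum scaler_suml; apply: eq_bigr => a _.
  rewrite -[LHS]/(mpolyC n (c a) *: (val (z a) F)) gE scalerA.
  by congr (_ *: _); rewrite /= mpolyCM.
have -> : \sum_a c a * g a F = 0.
  by rewrite -[RHS](cg F) ?inE //; apply: eq_bigl => a; rewrite inE.
by rewrite mpolyC0 scale0r.
Qed.
End LocalCohomologyDim.

(** * Stability *)

Lemma chain_frame (k : fieldType) (N : nat) (V : 'I_N -> lmodType k)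
    (A : forall j i : 'I_N, (i <= j)%N -> {linear V j -> V i}) :
  (forall (j : 'I_N) (jj : (j <= j)%N) x, A j j jj x = x) ->
  (forall (l j i : 'I_N) (jl : (j <= l)%N) (ij : (i <= j)%N) (il : (i <= l)%N) x,
    A l i il x = A j i ij (A l j jl x)) ->
  (forall j, exists d, dim_le (V j) d) ->
  exists (I : finType) (p q : I -> 'I_N) (x : I -> forall j, V j),
    frame (le := fun i j : 'I_N => (i <= j)%N) A (fun a j => (p a <= j <= q a)%N) x.
Proof.
move=> A_id A_comp fin_dim.
have /choice[D VD] : forall j, exists W : vectType k, V j = W.
  by move=> j; have [d] := fin_dim j; apply: dim_le_vectType.
have VE : V = (fun j => D j : lmodType k) by apply/funext.
subst V; clear VD fin_dim.
(* Extending the maps by 0 to all pairs of positions removes the dependence on a proof of i <= j. *)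
pose A' j i : 'Hom(D j, D i) :=
  if (i <= j)%N =P true is ReflectT ij then linfun (A j i ij) else 0.
have A'E (j i : 'I_N) (ij : (i <= j)%N) y : A' j i y = A j i ij y.
  rewrite /A'; case: eqP => [ij'|//]; rewrite lfunE /=.
  by rewrite (bool_irrelevance ij' ij).
have A'_id j y : A' j j y = y by rewrite (A'E _ _ (leqnn j)) A_id.
have A'_comp (l j i : 'I_N) y : (i <= j)%N -> (j <= l)%N -> A' j i (A' l j y) = A' l i y.
  move=> ij jl; rewrite (A'E _ _ ij) (A'E _ _ jl) (A'E _ _ (leq_trans ij jl)).
  exact/esym/A_comp.
have [|I [p [q [x [_ x0 Ax span_x free_x]]]]] :=
  chain_decomposition A'_id A'_comp (U := fun j => fullv).
  by move=> *; apply: memvf.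
exists I, p, q, x; split=> [//|a t s st al|t y|//].
  by rewrite -A'E Ax.
exact: span_x (memvf y).
Qed.

Section SortedCount.
Variables (T : Type) (le : rel T) (P : pred T).
Hypotheses (le_tr : transitive le) (P_down : forall x y, le x y -> P y -> P x).

(** A downward closed predicate holds exactly on an initial segment of a sorted list. *)
Lemma nth_sorted_count x0 (s : seq T) j : sorted le s -> (j < size s)%N ->
  P (nth x0 s j) = (j < count P s)%N.
Proof.
elim: s j => //= x s IH j x_s; have s_sorted := path_sorted x_s.
have [Px|Px] := boolP (P x); first by case: j => [|j] /=; [rewrite Px | rewrite add1n !ltnS; apply: IH].
have s0 : count P s = 0%N.
  apply/eqP; rewrite -leqn0 leqNgt -has_count -all_predC.
  have := order_path_min le_tr x_s; apply: sub_all => y xy /=.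
  by apply: contra Px; apply: P_down.
by rewrite s0; case: j => [|j] /=; [rewrite (negPf Px) | move=> js; rewrite IH ?s0].
Qed.
End SortedCount.

Section Stability.
Variables (R : realType) (k : fieldType) (n : nat) (Delta : {set {set 'I_n}}).
Variables (i : 'I_n) (q : nat) (alpha : multideg n).
Implicit Types (f g : {set 'I_n} -> R) (Gamma : {set {set 'I_n}}).

Let M Gamma : lmodType k := lcoh_deg [set~ i] (sr_module k Gamma) q alpha.
Let V f : pmodule R k := lc_pmodule k Delta f i q alpha.

Let restr Gamma Gamma' (sub : Gamma' \subset Gamma) : {linear M Gamma -> M Gamma'} :=
  lcoh_deg_map [set~ i] (sr_map k sub) q alpha.

Let restr_id Gamma (sub : Gamma \subset Gamma) x : restr sub x = x.
Proof. by apply: lcoh_deg_map_id => u; apply: sr_map_id. Qed.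

Let restr_comp (G1 G2 G3 : {set {set 'I_n}}) (s21 : G2 \subset G1) (s32 : G3 \subset G2) (s31 : G3 \subset G1) x :
  restr s31 x = restr s32 (restr s21 x).
Proof. by apply: lcoh_deg_map_comp => u; apply: sr_map_comp. Qed.

(** * Functions sorted by one list of faces *)

Section CommonOrder.
Variable s : seq {set 'I_n}.
Hypothesis s_Delta : forall sigma, (sigma \in s) = (sigma \in Delta).

(** One position for each initial segment, the empty and the full one included. *)
Let N := (size s).+1.
Let K (j : nat) : {set {set 'I_n}} := [set sigma in take j s].

Let K_sub (j l : nat) : (j <= l)%N -> K j \subset K l.
Proof.
move=> jl; apply/fintype.subsetP => sigma; rewrite !inE => h.
by rewrite -(subnKC jl) takeD mem_cat h.
Qed.

(* K p is born with the last element of the segment; the bar [p, r] of positions dies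
   when K r is replaced by K r.+1. *)
Definition birth f (p : 'I_N) : itv_bound R :=
  if val p is p'.+1 then BLeft (f (nth finset.set0 s p')) else -oo%O.
Definition death f (q : 'I_N) : itv_bound R :=
  if (q < size s)%N then BLeft (f (nth finset.set0 s q)) else +oo%O.
Definition life f (p q : 'I_N) : interval R := Interval (birth f p) (death f q).

Definition rank f (t : R) : 'I_N := inord (count (fun sigma => f sigma <= t) s).

Let rankE f t : rank f t = count (fun sigma => f sigma <= t) s :> nat.
Proof. by rewrite inordK // ltnS count_size. Qed.

Section Sorted.
Variable f : {set 'I_n} -> R.
Hypothesis s_sorted : sorted (fun sigma tau => f sigma <= f tau) s.

Let rank_nth t j : (j < size s)%N -> (f (nth finset.set0 s j) <= t) = (j < rank f t)%N.
Proof.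
move=> js; rewrite rankE.
apply: (nth_sorted_count (P := fun sigma => f sigma <= t)) s_sorted js.
  by move=> x y z; apply: le_trans.
by move=> x y /= xy; apply: le_trans.
Qed.

Let sublevel_rank t : sublevel Delta f t = K (rank f t).
Proof.
apply/setP => sigma; rewrite !inE -s_Delta.
have [ss|ss] := boolP (sigma \in s); last first.
  by apply/esym/negP => /mem_take; apply/negP.
by rewrite in_take // -rank_nth ?index_mem // nth_index.
Qed.

(** [BLeft] closes the lower end and opens the upper one: position p is reached at the birth value,
    position r is left at the death value. *)
Let mem_life t (p r : 'I_N) : (t \in life f p r) = (p <= rank f t <= r)%N.
Proof.
rewrite itv_boundlr /birth /death; congr (_ && _).
  by case: p => [[|p] pN] //=; rewrite bnd_simp rank_nth.
case: ifP => [rs|/negbT]; first by rewrite bnd_simp ltNge rank_nth // -leqNgt.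
rewrite -leqNgt bnd_simp => /(leq_trans _) -> //.
by rewrite -ltnS.
Qed.

Let rank_mono t t' : t' <= t -> (rank f t' <= rank f t)%N.
Proof.
by move=> tt'; rewrite !rankE; apply: sub_count => sigma /= /le_trans; apply.
Qed.

Lemma chain_is_barcode (I : finType) (p r : I -> 'I_N) (x : I -> forall j, M (K (val j))) :
  frame (le := fun i j : 'I_N => (i <= j)%N) (V := fun j : 'I_N => M (K j))
    (fun j l lj => restr (K_sub lj)) (fun a (j : 'I_N) => (p a <= j <= r a)%N) x ->
  is_barcode (V f) [seq life f (p a) (r a) | a <- enum I & `[< exists t, t \in life f (p a) (r a) >]].
Proof.
move=> F.
(* The equal families are identified by mutually inverse restrictions, instead of transport along
   the equality. *)
have subK t : sublevel Delta f t \subset K (rank f t) by rewrite sublevel_rank.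
have Ksub t : K (rank f t) \subset sublevel Delta f t by rewrite sublevel_rank.
have F' := @frame_pullback k _ R _ (fun t' t => t' <= t) _ (fun t => V f t) _
  (@Defs.pmap R k (V f)) (rank f) rank_mono (fun t => restr (subK t)) _ _ _ _ _ F.
apply: (@frame_is_barcode _ _ _ _ (fun a => life f (p a) (r a)) _
  (fun a => `[< exists t, t \in life f (p a) (r a) >]) (fun=> erefl)); rewrite /barcode_frame.
have -> : (fun a t => t \in life f (p a) (r a)) = (fun a t => (p a <= rank f t <= r a)%N).
  by apply/funext => a; apply/funext => t; rewrite mem_life.
apply: F' => [t|t t' tt' y].
  by exists (restr (Ksub t)) => y; rewrite -restr_comp restr_id.
have sub : sublevel Delta f t' \subset K (rank f t).
  exact: fintype.subset_trans (subK t') (K_sub (rank_mono tt')).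
transitivity (restr sub y); last exact: restr_comp.
exact: esym (restr_comp (subK t) (sublevel_sub Delta f tt') sub y).
Qed.
End Sorted.

(** The positions p and r are chosen before f: this is what pairs the bars of two functions. *)
Lemma common_chain : exists (I : finType) (p r : I -> 'I_N), forall f,
  sorted (fun sigma tau => f sigma <= f tau) s ->
  is_barcode (V f) [seq life f (p a) (r a) | a <- enum I & `[< exists t, t \in life f (p a) (r a) >]].
Proof.
have [|||I [p [r [x F]]]] := @chain_frame k N (fun j => M (K j)) (fun j l lj => restr (K_sub lj)).
- by move=> j jj x; apply: restr_id.
- by move=> l j l' jl l'j l'l x; apply: restr_comp.
- by move=> j; exists #|{set 'I_n}|; apply: lcoh_deg_dim.
by exists I, p, r => f s_sorted; apply: chain_is_barcode F.
Qed.

Section Match.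
Variables (f g : {set 'I_n} -> R) (d : R).
Hypotheses (d0 : 0 <= d) (fg : forall sigma, sigma \in Delta -> `|f sigma - g sigma| <= d).

Let fg_nth j : (j < size s)%N ->
  `|f (nth finset.set0 s j) - g (nth finset.set0 s j)| <= d.
Proof. by move=> js; apply: fg; rewrite -s_Delta mem_nth. Qed.

Lemma life_bar_dist p r : (bar_dist (life f p r) (life g p r) <= d%:E)%E.
Proof.
rewrite /bar_dist ge_max; apply/andP; split.
  case: p => [[|p] pN]; first exact: endpoint_dist_refl.
  exact/endpoint_dist_le/fg_nth.
rewrite /= /death; case: ifP => rs; last exact: endpoint_dist_refl.
exact/endpoint_dist_le/fg_nth.
Qed.

(** A bar empty for g has its g-death at or before its g-birth; passing to f lengthens it by at most
    2d, and half of that is d. *)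
Lemma life_diag_dist p r :
  ~ (exists t, t \in life g p r) -> (diag_dist (life f p r) <= d%:E)%E.
Proof.
rewrite /life /birth /death => g_empty; case: p g_empty => [[|p] pN] /=.
  case: ifP => _ g_empty; exfalso; apply: g_empty; last by exists 0.
  by exists (g (nth finset.set0 s r) - 1); rewrite in_itv /=; lra.
case: ifP => rs g_empty; last first.
  by exfalso; apply: g_empty; exists (g (nth finset.set0 s p)); rewrite in_itv /= lexx.
have gle : g (nth finset.set0 s r) <= g (nth finset.set0 s p).
  rewrite leNgt; apply/negP => lt_g; apply: g_empty.
  by exists (g (nth finset.set0 s p)); rewrite in_itv /= lexx.
rewrite /diag_dist /= -EFinB -EFinM lee_fin.
by have := fg_nth rs; have := fg_nth pN; rewrite !ler_norml => /andP[? ?] /andP[? ?]; lra.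
Qed.
End Match.

Lemma life_matched f g d (I : finType) (p r : I -> 'I_N) : 0 <= d ->
  (forall sigma, sigma \in Delta -> `|f sigma - g sigma| <= d) ->
  matched d
    [seq life f (p a) (r a) | a <- enum I & `[< exists t, t \in life f (p a) (r a) >]]
    [seq life g (p a) (r a) | a <- enum I & `[< exists t, t \in life g (p a) (r a) >]].
Proof.
move=> d0 fg; elim: (enum I) => [|a e IH]; first exact: matched_nil.
have gf sigma : sigma \in Delta -> `|g sigma - f sigma| <= d by rewrite distrC; apply: fg.
rewrite /=; case: asboolP => [fP|fP]; case: asboolP => [gP|gP] //=.
- by apply: matched_cons IH; apply: life_bar_dist.
- by apply: matched_consl IH; apply: life_diag_dist gP.
by apply: matched_consr IH; apply: life_diag_dist fP.
Qed.
End CommonOrder.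

(** Only strict reversals count, since a tie of one function is compatible with any order of the
    other. *)
Definition discordant f g : {set {set 'I_n} * {set 'I_n}} :=
  [set b | [&& b.1 \in Delta, b.2 \in Delta, f b.1 < f b.2 & g b.2 < g b.1]].

Lemma concordant_stability f g d : discordant f g = finset.set0 -> 0 <= d ->
  (forall sigma, sigma \in Delta -> `|f sigma - g sigma| <= d) ->
  exists B C, [/\ is_barcode (V f) B, is_barcode (V g) C & matched d B C].
Proof.
(* Without strict reversals, f + g sorts both functions at once: if one of them strictly decreased,
   the other could not increase, and the sum would drop. *)
move=> conc d0 fg; pose le sigma tau := f sigma + g sigma <= f tau + g tau.
pose s := sort le (enum Delta).
have s_Delta sigma : (sigma \in s) = (sigma \in Delta) by rewrite mem_sort mem_enum.
have s_sorted : sorted le s by apply: sort_sorted => x y; apply: le_total.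
have conc' sigma tau : sigma \in Delta -> tau \in Delta -> f sigma < f tau -> g sigma <= g tau.
  move=> sD tD f_lt; rewrite leNgt; apply/negP => g_lt.
  by have /setP/(_ (sigma, tau)) := conc; rewrite !inE /= sD tD f_lt g_lt.
have sub_sorted h : (forall sigma tau, sigma \in Delta -> tau \in Delta ->
    le sigma tau -> h sigma <= h tau) -> sorted (fun sigma tau => h sigma <= h tau) s.
  move=> le_h; move: s_sorted; apply: (sub_in_sorted (P := mem Delta)).
    by move=> sigma tau sD tD; apply: le_h.
  by apply/allP => sigma; rewrite s_Delta.
have [I [p [r BP]]] := common_chain s_Delta.
do 2!eexists; split; [apply: BP | apply: BP | exact: life_matched].
  apply: sub_sorted => sigma tau sD tD; rewrite /le leNgt => st; rewrite leNgt.
  apply/negP => f_lt; have := conc' _ _ tD sD f_lt; move: st f_lt; rewrite -leNgt; lra.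
apply: sub_sorted => sigma tau sD tD; rewrite /le => st.
rewrite leNgt; apply/negP => g_lt; have [f_lt|] := ltP (f sigma) (f tau); last lra.
by have := conc' _ _ sD tD f_lt; lra.
Qed.

(* Induction on the number of discordant pairs: up to the first crossing, f and the
   interpolation h are concordant, and the crossing pair is no longer discordant for
   h and g. *)
Lemma interleaved_stability f g d : 0 <= d ->
  (forall sigma, sigma \in Delta -> `|f sigma - g sigma| <= d) ->
  exists B C, [/\ is_barcode (V f) B, is_barcode (V g) C & matched d B C].
Proof.
have [m] := ubnP #|discordant f g|; elim: m f d => // m IH f d; rewrite ltnS => le_m d0 fg.
have [conc|/set0Pn[b0 b0P]] := eqVneq (discordant f g) finset.set0.
  exact: concordant_stability.
(* The parameter at which f + u (g - f) takes equal values on the two faces of the pair. *)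
pose cross (b : {set 'I_n} * {set 'I_n}) := (f b.2 - f b.1) / ((f b.2 - f b.1) + (g b.1 - g b.2)).
have [b bP bmin] := @arg_minP _ _ _ b0 (mem (discordant f g)) cross b0P.
set u := cross b in bmin.
have discP c : c \in discordant f g -> [/\ c.1 \in Delta, c.2 \in Delta, f c.1 < f c.2 & g c.2 < g c.1].
  by rewrite inE => /and4P[].
have crossP c : c \in discordant f g ->
    f c.2 - f c.1 = cross c * ((f c.2 - f c.1) + (g c.1 - g c.2)).
  by move=> /discP[_ _ f_lt g_lt]; rewrite /cross divfK //; lra.
have [u0 u1] : 0 <= u /\ u <= 1.
  have [_ _ f_lt g_lt] := discP _ bP.
  split; first by rewrite /u /cross divr_ge0; lra.
  by rewrite /u /cross ler_pdivrMr; lra.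
pose h sigma := f sigma + u * (g sigma - f sigma).
(* As h lies between f and g, a pair ordered by f and reversed by h is reversed by g too; it would
   then have crossed before u, against minimality. *)
have disc_fh : discordant f h = finset.set0.
  apply/setP => c; rewrite !inE; apply/negP => /and4P[c1 c2 f_lt h_lt].
  have g_lt : g c.2 < g c.1.
    rewrite ltNge; apply/negP => g_le.
    by move: h_lt; rewrite /h; nra.
  have cP : c \in discordant f g by rewrite inE c1 c2 f_lt.
  by have := bmin c cP; have := crossP c cP; move: h_lt; rewrite /h; nra.
have disc_hg : discordant h g \subset discordant f g :\ b.
  apply/fintype.subsetP => c; rewrite !inE => /and4P[c1 c2 h_lt g_lt].
  rewrite c1 c2 g_lt andbT /=; apply/andP; split.
    apply: contraTneq h_lt => ->; have := crossP b bP; rewrite -/u /h -leNgt; lra.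
  by rewrite ltNge; apply/negP => f_le; move: h_lt; rewrite /h; nra.
have card_hg : (#|discordant h g| < m)%N.
  apply: leq_trans le_m; apply: leq_ltn_trans (subset_leq_card disc_hg) _.
  by rewrite [X in (_ < X)%N](cardsD1 b) [b \in _]bP.
have fh sigma : sigma \in Delta -> `|f sigma - h sigma| <= u * d.
  move=> sD; rewrite /h opprD addrA subrr add0r -mulrN opprB normrM ger0_norm //.
  by rewrite ler_wpM2l ?fg.
have hg sigma : sigma \in Delta -> `|h sigma - g sigma| <= (1 - u) * d.
  move=> sD; have -> : h sigma - g sigma = (1 - u) * (f sigma - g sigma) by rewrite /h; lra.
  by rewrite normrM ger0_norm ?subr_ge0 // ler_wpM2l ?fg ?subr_ge0.
have ud : 0 <= u * d by rewrite mulr_ge0.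
have u1d : 0 <= (1 - u) * d by rewrite mulr_ge0 ?subr_ge0.
have [B [D [fB hD BD]]] := concordant_stability disc_fh ud fh.
have [D' [C [hD' gC DC]]] := IH h _ card_hg u1d hg.
exists B, C; split=> //.
(* The middle 0 pays for passing between D and [D'], two barcodes of the module of h. *)
have -> : d = u * d + 0 + (1 - u) * d by lra.
apply: matched_trans DC; rewrite ?addr0 //.
rewrite -[u * d]addr0; apply: matched_trans BD _ => //.
exact/matched_perm/(is_barcode_perm hD).
Qed.

Lemma lc_barcode_stability f g d : 0 <= d ->
  (forall sigma, sigma \in Delta -> `|f sigma - g sigma| <= d) ->
  (bottleneck (lc_barcode k Delta f i q alpha) (lc_barcode k Delta g i q alpha) <= d%:E)%E.
Proof.
move=> d0 fg; have [B [C [fB gC BC]]] := interleaved_stability d0 fg.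
(* [barcode] falls back on the empty list, so the existence of some barcode has to be supplied. *)
have barcodeP h B' : is_barcode (V h) B' -> is_barcode (V h) (lc_barcode k Delta h i q alpha).
  by move=> hB'; apply: xgetPex; exists B'.
have b_B : matched 0 (lc_barcode k Delta f i q alpha) B.
  exact/matched_perm/(is_barcode_perm (barcodeP _ _ fB)).
have C_c : matched 0 C (lc_barcode k Delta g i q alpha).
  exact/matched_perm/(is_barcode_perm gC)/(barcodeP _ _ gC).
apply: bottleneck_le => //; have := matched_trans _ _ (matched_trans _ _ b_B BC) C_c.
by rewrite add0r addr0; apply.
Qed.
End Stability.

Lemma sup_dist_ge (R : realType) n (Delta : {set {set 'I_n}}) (f g : {set 'I_n} -> R) sigma :
  sigma \in Delta -> `|f sigma - g sigma| <= sup_dist Delta f g.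
Proof.
move=> sD; apply: ub_le_sup; last by exists sigma.
(* A sum of nonnegative terms bounds each of them, so the set has an upper bound. *)
exists (\sum_sigma `|f sigma - g sigma|) => _ [tau _ <-].
by rewrite (bigD1 tau) //= lerDl sumr_ge0.
Qed.

Theorem theorem3p18 (R : realType) (k : fieldType) (n : nat)
    (Delta : {set {set 'I_n}})
    (Delta_complex : simplicial_complex Delta)
    (Delta_vertices : forall v : 'I_n, [set v]%SET \in Delta)
    (f g : {set 'I_n} -> R)
    (f_mono : monotonic Delta f) (g_mono : monotonic Delta g)
    (i : 'I_n) (q : nat) :
  [/\ forall alpha : multideg n,
        (bottleneck (lc_barcode k Delta f i q alpha) (lc_barcode k Delta g i q alpha)
          <= (sup_dist Delta f g)%:E)%E,
      forall sigma : {set 'I_n}, sigma \in del Delta i ->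
        (bottleneck (del_barcode k Delta f i q sigma) (del_barcode k Delta g i q sigma)
          <= (sup_dist Delta f g)%:E)%E
    & forall sigma : {set 'I_n}, sigma \in lk Delta i ->
        (bottleneck (lk_barcode k Delta f i q sigma) (lk_barcode k Delta g i q sigma)
          <= (sup_dist Delta f g)%:E)%E].
Proof.
have stab alpha : (bottleneck (lc_barcode k Delta f i q alpha)
    (lc_barcode k Delta g i q alpha) <= (sup_dist Delta f g)%:E)%E.
  apply: lc_barcode_stability => [|sigma]; last exact: sup_dist_ge.
  (* The vertex i is a face, so the supremum dominates an absolute value and is nonnegative. *)
  exact: le_trans (normr_ge0 _) (sup_dist_ge f g (Delta_vertices i)).
by split=> [//|sigma _|sigma _]; apply: stab.
Qed.
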